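(* Let $(p_N)_N$ be a family of Markov chains on $\mathcal S_N=\{-1,1\}^N$ of the single-site form described in the context (reversible with respect to $\mu_N$, with update probabilities bounded by $\alpha<1$), let $\underline m^{n}$ be the mesoscopic maps described in the context, and assume (A.1) and (A.2). Let $A,B\subset\mathcal S_N$ be sets as in the context for which the recurrence hypothesis (R) holds with constant $C>0$. Then, for all sufficiently large $N$, $$\max_{\sigma,\eta\in A}\left|\frac{\mathbb E_\sigma\tau_B}{\mathbb E_\eta\tau_B}-1\right|\le e^{-CN/2}.$$
   Context: Setting. $N$ is a large integer parameter, $\Lambda=\{1,\dots,N\}$, $\mathcal S_N=\{-1,1\}^N$. For each $N$, $(\sigma(t))_{t=0,1,2,\dots}$ is a discrete-time Markov chain on $\mathcal S_N$ with transition probabilities $p_N$, reversible with respect to a probability (Gibbs) measure $\mu_N$. The chain has the following structure: at each step a site $x\in\Lambda$ is chosen uniformly with probability $1/N$, and then the spin at $x$ is set to $\pm1$ with probability $p_x^{\pm}(\sigma)$, where $\sigma$ is the current configuration and $p_x^+(\sigma)+p_x^-(\sigma)=1$; all other spins are unchanged. There is $\alpha\in[1/2,1)$, independent of $N$, such that $\max_{x,\sigma,\pm}p_x^\pm(\sigma)\le\alpha$. $\mathbb P_\sigma,\mathbb E_\sigma$ denote law and expectation for the chain started in $\sigma$, and $\tau_D=\min\{t>0:\sigma(t)\in D\}$ for $D\subset\mathcal S_N$. Mesoscopic maps. For each $n$ there is a partition $\{\Lambda^n_1,\dots,\Lambda^n_{k_n}\}$ of $\Lambda$; the partitions are nested (the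 $(n+1)$-st refines the $n$-th). Put $m^n_i(\sigma)=\frac1N\sum_{x\in\Lambda^n_i}\sigma_x$, $\underline m^n=(m^n_1,\dots,m^n_{k_n})$, let $\Gamma_n\subset\mathbb R^{k_n}$ be the set of values of $\underline m^n$, and $\mathcal S^n[\underline m]=\{\sigma:\underline m^n(\sigma)=\underline m\}$. Let $\mathcal Q_n=\mu_N\circ(\underline m^n)^{-1}$ and $$r_N(\underline m,\underline m')=\frac1{\mathcal Q_n(\underline m)}\sum_{\sigma\in\mathcal S^n[\underline m],\ \sigma'\in\mathcal S^n[\underline m']}\mu_N(\sigma)p_N(\sigma,\sigma').$$ (A.1) There is a sequence $\varepsilon(n)\downarrow0$ such that for all $n$, all $N$, all $\underline m,\underline m'\in\Gamma_n$ with $r_N(\underline m,\underline m')>0$, and all $\sigma\in\mathcal S^n[\underline m]$, $\sigma'\in\mathcal S^n[\underline m']$ with $p_N(\sigma,\sigma')>0$, $$\left|\frac{p_N(\sigma,\sigma')\,|\{\sigma''\in\mathcal S^n[\underline m']:p_N(\sigma,\sigma'')>0\}|}{r_N(\underline m,\underline m')}-1\right|\le\varepsilon(n).$$ (A.2) If $\underline m^n(\sigma)=\underline m^n(\eta)$ and $\sigma_x=\eta_x$, then $p_x^\pm(\sigma)=p_x^\pm(\eta)$. Sets $A,B$ and hypothesis (R). There are $n_0$ and sets $\mathbf A,\mathbf B\subset\Gamma_{n_0}$ with $A=\{\sigma\in\mathcal S_N:\underline m^{n_0}(\sigma)\in\mathbf A\}$ and $B=\{\sigma\in\mathcal S_N:\underline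 m^{n_0}(\sigma)\in\mathbf B\}$ disjoint, and (R): there are a constant $C>0$ and a sequence $a_n<\infty$ (independent of $N$) such that for all $n\ge n_0$ and all $\sigma,\eta\in A$, $$\mathbb P_\sigma\big[\tau_B<\tau_{\mathcal S^n[\underline m^n(\eta)]}\big]\le a_n e^{-CN}.$$ *)

(* Defs.v *)
From HB Require Import structures.
From mathcomp Require Import all_boot all_order all_algebra.
From mathcomp Require Import all_classical all_reals all_analysis.

Set Implicit Arguments.
Unset Strict Implicit.
Unset Printing Implicit Defensive.

Import Order.TTheory GRing.Theory Num.Theory.
Import numFieldNormedType.Exports.

Local Open Scope classical_set_scope.
Local Open Scope ring_scope.

(* The spin set {-1, 1} is coded by bool: true is +1, false is -1. *)
Definition config (N : nat) := {ffun 'I_N -> bool}.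

Definition spin (R : realType) (b : bool) : R := if b then 1 else -1.

Definition set_spin (N : nat) (s : config N) (x : 'I_N) (b : bool) : config N :=
  [ffun y => if y == x then b else s y].

(* [q x b s] is p_x^+(s) for b = true and p_x^-(s) for b = false. *)
Definition trans (R : realType) (N : nat) (q : 'I_N -> bool -> config N -> R)
    (s s' : config N) : R :=
  \sum_(x < N) N%:R^-1 *
    \sum_(b : bool) (if s' == set_spin s x b then q x b s else 0).

Definition update_probabilities (R : realType) (N : nat)
    (q : 'I_N -> bool -> config N -> R) : Prop :=
  (forall x b s, 0 <= q x b s) /\ (forall x s, q x true s + q x false s = 1).

Definition prob_mass (R : realType) (T : finType) (mu : T -> R) : Prop :=
  (forall s, 0 <= mu s) /\ \sum_(s : T) mu s = 1.

Definition reversible (R : realType) (T : finType) (p : T -> T -> R)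
    (mu : T -> R) : Prop :=
  forall s s', mu s * p s s' = mu s' * p s' s.

Definition cylinder (Om T : Type) (X : nat -> Om -> T) (s : nat -> T) (t : nat)
    : set Om :=
  [set w | forall i, (i <= t)%N -> X i w = s i].

(* The last clause is the Markov property, multiplied out so that no
   conditioning on null events occurs. *)
Definition markov_chain (R : realType) (T : finType) (p : T -> T -> R)
    (d : measure_display) (Om : measurableType d) (s0 : T)
    (P : probability Om R) (X : nat -> Om -> T) : Prop :=
  [/\ forall t x, measurable (X t @^-1` [set x]),
      P (X 0%N @^-1` [set s0]) = 1%E
    & forall (s : nat -> T) (t : nat),
        P (cylinder X s t.+1) = (P (cylinder X s t) * (p (s t) (s t.+1))%:E)%E].

(* min {t > 0 : X_t \in D}, equal to +oo if D is not visited at a time t > 0 *)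
Definition hit (R : realType) (Om : Type) (T : finType) (X : nat -> Om -> T)
    (D : {set T}) (w : Om) : \bar R :=
  ereal_inf [set t%:R%:E | t in [set t : nat | (0 < t)%N /\ X t w \in D]].

Definition is_partition (N k : nat) (L : 'I_k -> {set 'I_N}) : Prop :=
  injective L /\ finset.partition (L @: finset.setT) finset.setT.

Definition refines (N k k' : nat) (L' : 'I_k' -> {set 'I_N})
    (L : 'I_k -> {set 'I_N}) : Prop :=
  forall j, exists i, L' j \subset L i.

Definition meso (R : realType) (N k : nat) (L : 'I_k -> {set 'I_N})
    (s : config N) : 'rV[R]_k :=
  \row_(i < k) (N%:R^-1 * \sum_(x in L i) spin R (s x)).

Definition Gamma (R : realType) (N k : nat) (L : 'I_k -> {set 'I_N})
    : set 'rV[R]_k :=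
  range (meso R L).

Definition level (R : realType) (N k : nat) (L : 'I_k -> {set 'I_N})
    (v : 'rV[R]_k) : {set config N} :=
  finset.finset (fun s => meso R L s == v).

Definition meso_set (R : realType) (N k : nat) (L : 'I_k -> {set 'I_N})
    (V : set 'rV[R]_k) : {set config N} :=
  finset.finset (fun s => meso R L s \in V).

Definition meso_mass (R : realType) (N k : nat) (L : 'I_k -> {set 'I_N})
    (mu : config N -> R) (v : 'rV[R]_k) : R :=
  \sum_(s in level L v) mu s.

Definition meso_rate (R : realType) (N k : nat) (L : 'I_k -> {set 'I_N})
    (mu : config N -> R) (p : config N -> config N -> R) (v v' : 'rV[R]_k) : R :=
  (meso_mass L mu v)^-1 *
    \sum_(s in level L v) \sum_(s' in level L v') mu s * p s s'.

Definition assumption_A1 (R : realType) (N k : nat) (L : 'I_k -> {set 'I_N})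
    (mu : config N -> R) (p : config N -> config N -> R) (e : R) : Prop :=
  forall v v', Gamma L v -> Gamma L v' -> 0 < meso_rate L mu p v v' ->
  forall s s', s \in level L v -> s' \in level L v' -> 0 < p s s' ->
  `| p s s' * #|finset.finset (fun s'' => (s'' \in level L v') && (0 < p s s''))|%:R
       / meso_rate L mu p v v' - 1 | <= e.

Definition assumption_A2 (R : realType) (N k : nat) (L : 'I_k -> {set 'I_N})
    (q : 'I_N -> bool -> config N -> R) : Prop :=
  forall s t x, meso R L s = meso R L t -> s x = t x ->
  forall b, q x b s = q x b t.

(* Main.v *)
Require Import Defs.
From HB Require Import structures.
From mathcomp Require Import all_boot all_order all_algebra all_fingroup.
From mathcomp Require Import all_classical all_reals all_analysis.
From mathcomp Require Import ring lra measurable_realfun.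

Set Implicit Arguments.
Unset Strict Implicit.
Unset Printing Implicit Defensive.

Import Order.TTheory GRing.Theory Num.Theory.
Import numFieldNormedType.Exports.

Local Open Scope classical_set_scope.
Local Open Scope ring_scope.

(** Why the mean hitting times of B are almost constant on A.

    Fix a level n and let S be the level set, for the n-th magnetization, of a
    point s of A. By (R), a chain started in A reaches S before B up to
    probability delta = a_n e^(-CN). Let G be the mean hitting time of B and m
    its minimum on S. Then G >= (1 - delta) m on A, so it remains to show that
    G s is not much larger than m.

    Subtract from G the part due to returning to S: the excess
    w = G - m P(S before B) is nonnegative, satisfies w <= 1 + P w off B, and is
    superharmonic off B up to an error m delta coming from escapes out of S
    (lemmas excess_ge0, excess_sub, excess_super). It vanishes at a minimizer t
    of G on S. A Harnack inequality between points of one level set (lemma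
    harnack) then gives
      G s - m = w s <= poly(N) + e^(kappa N) poly(N) m delta
    with kappa as small as desired, and since m >= 1 / delta
    (min_lower_bound) the first term is absorbed by the second. With
    kappa <= C / 4 this is m times something far below e^(-CN/2).

    The Harnack inequality comes from a coupling of two chains with equal
    magnetization. A permutation of the sites (lemma matching) fixes the sites
    where the configurations agree and pairs the others within blocks, value by
    value; when the first chain flips x, the second flips the partner of x. By
    (A.2) the flips of agreeing sites have exactly equal probabilities, so losses
    come only from disagreeing sites, where (A.1) bounds them (lemma
    rate_ratio): a factor rho = 1 + O(eps n) for each of their at most N flips,
    and, through the holding probabilities, a factor 1 + O(eps n) j / N for each
    step with j disagreeing sites. Each such step also removes a disagreement
    with probability at least (1 - alpha) j / N. Stopping when the numbers j
    have added up to K N^2 therefore costs a factor e^(O(eps n) K N) in all, and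
    the probability that the chains have not met by then is at most
    2^N e^(-(1 - alpha) K N / 2).

    If the chains do not meet, w is only known to be at most the crude bound
    (e^2 / (1 - alpha))^N, valid because every configuration reaches B within N
    steps with probability at least ((1 - alpha) / e)^N (subsolution_bound).
    Taking K large, depending on alpha only, makes this contribution at most 1;
    n is chosen after K, and N after n.

    No path measure is needed in this argument, which deals with functions on
    configurations only. The link with the process is made by integral_hit and
    green_escape_le, which identify the expectation of the hitting time and
    bound the escape probability by expanding both over time. *)

(** * One step of the dynamics *)

(** The one-step expectation (P f)(s) of the kernel p. *)
Definition average (R : realType) (T : finType) (p : T -> T -> R)
    (f : T -> R) (s : T) : R :=
  \sum_(s' : T) p s s' * f s'.

Definition flip (N : nat) (s : config N) (x : 'I_N) : config N :=
  set_spin s x (~~ s x).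

Definition rate (R : realType) (N : nat) (q : 'I_N -> bool -> config N -> R)
    (x : 'I_N) (s : config N) : R := q x (~~ s x) s.

Section Dynamics.
Context (R : realType) (N : nat) (q : 'I_N -> bool -> config N -> R).
Implicit Types (s t : config N) (x y : 'I_N) (f : config N -> R).

Lemma set_spin_id s x : set_spin s x (s x) = s.
Proof. by apply/ffunP => y; rewrite ffunE; case: eqP => [->|]. Qed.

Lemma flipE s x y : flip s x y = if y == x then ~~ s x else s y.
Proof. by rewrite ffunE. Qed.

Lemma flip_inj s : injective (flip s).
Proof.
move=> x y /ffunP /(_ x); rewrite !flipE eqxx.
by case: (x =P y) => // _; case: (s x).
Qed.

Lemma flip_neq s x : flip s x != s.
Proof. by apply/eqP => /ffunP /(_ x); rewrite flipE eqxx; case: (s x). Qed.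

Lemma average_spin_sum f s :
  average (trans q) f s =
  N%:R^-1 * \sum_(x < N) \sum_(b : bool) q x b s * f (set_spin s x b).
Proof.
rewrite /average /trans mulr_sumr.
under eq_bigr do rewrite mulr_suml.
rewrite exchange_big; apply: eq_bigr => x _.
under eq_bigr do rewrite -mulrA mulr_suml.
rewrite -mulr_sumr exchange_big; congr (_ * _); apply: eq_bigr => b _.
rewrite (bigD1 (set_spin s x b)) //= eqxx big1 ?addr0// => t /negbTE ->.
by rewrite mul0r.
Qed.

Lemma trans_average s t : trans q s t = average (trans q) (fun t' => (t' == t)%:R) s.
Proof.
rewrite /average (bigD1 t) //= eqxx mulr1 big1 ?addr0// => t' /negbTE ->.
by rewrite mulr0.
Qed.

Hypothesis N_gt0 : (0 < N)%N.
Hypothesis q_prob : update_probabilities q.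

Lemma q_stay x s : q x (s x) s = 1 - rate q x s.
Proof. by rewrite /rate -(q_prob.2 x s); case: (s x) => /=; ring. Qed.

Lemma N_neq0 : N%:R != 0 :> R.
Proof. by rewrite pnatr_eq0 -lt0n. Qed.

(** An update of the site x either flips it or leaves the configuration as it
    is; the second alternatives are collected into one holding term, because
    the coupling below treats flips site by site but holding globally. *)
Lemma averageE f s :
  average (trans q) f s =
  N%:R^-1 * (\sum_(x < N) rate q x s * f (flip s x)
             + (N%:R - \sum_(x < N) rate q x s) * f s).
Proof.
rewrite average_spin_sum; congr (_ * _).
transitivity (\sum_(x < N) (rate q x s * f (flip s x) + (1 - rate q x s) * f s)).
  apply: eq_bigr => x _; rewrite big_bool -q_stay /rate /flip.
  have := set_spin_id s x; case: (s x) => /= ->; by rewrite // addrC.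
rewrite big_split /= -mulr_suml; congr (_ + _ * _).
by rewrite sumrB sumr_const card_ord.
Qed.

Lemma trans_ge0 s t : 0 <= trans q s t.
Proof.
apply: sumr_ge0 => x _; rewrite mulr_ge0// sumr_ge0// => b _.
by case: ifP => // _; exact: q_prob.1.
Qed.

Lemma trans_sum1 s : \sum_t trans q s t = 1.
Proof.
transitivity (average (trans q) (fun=> 1) s).
  by apply: eq_bigr => t _; rewrite mulr1.
rewrite averageE mulr1 (eq_bigr (rate q ^~ s)); last by move=> x _; rewrite mulr1.
by rewrite addrC subrK mulVf// N_neq0.
Qed.

Lemma trans_flip s x : trans q s (flip s x) = N%:R^-1 * rate q x s.
Proof.
rewrite trans_average averageE (bigD1 x)//= eqxx mulr1 big1.
  by rewrite eq_sym (negbTE (flip_neq s x)) mulr0 !addr0.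
by move=> y yx; rewrite (inj_eq (@flip_inj s)) (negbTE yx) mulr0.
Qed.

Lemma trans_gt0_flip s t : 0 < trans q s t -> t != s -> exists x, t = flip s x.
Proof.
move=> + ts; apply: contraPP => /forallNP nt.
rewrite trans_average averageE big1 ?add0r.
  by rewrite eq_sym (negbTE ts) mulr0 mulr0 ltxx.
by move=> x _; case: eqP => [/esym/nt//|_]; rewrite mulr0.
Qed.

End Dynamics.

(** * Matching two configurations of equal magnetization *)

(** Two families with fibers of equal sizes list the same multiset of values, so
    one is a rearrangement of the other. *)
Lemma fiber_perm (n : nat) (T : eqType) (f g : 'I_n -> T) :
  (forall v, #|[pred x | f x == v]| = #|[pred x | g x == v]|) ->
  exists s : 'S_n, forall x, g (s x) = f x.
Proof.
move=> fg.
have : perm_eq [tuple f i | i < n] [tuple g i | i < n].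
  apply/allP => v _; have := fg v.
  by rewrite /= !count_map !cardE /enum_mem !size_filter => /eqP.
case/tuple_permP => s fgs; exists s => x.
have := congr1 (fun u : seq T => nth (f x) u x) fgs.
by rewrite !nth_mktuple tnth_mktuple => ->.
Qed.

Definition blocks (N k : nat) (L : 'I_k -> {set 'I_N}) (x : 'I_N) : {set 'I_k} :=
  finset.finset (fun i => x \in L i).

Definition disagree (N : nat) (s t : config N) : {set 'I_N} :=
  finset.finset (fun x => s x != t x).

Section Matching.
Context (R : realType) (N k : nat) (L : 'I_k -> {set 'I_N}).
Implicit Types (s t : config N) (x y z : 'I_N) (i : 'I_k).
Context (N_gt0 : (0 < N)%N) (L_part : is_partition L).

Lemma block_of x : exists i, x \in L i.
Proof.
have /and3P[/eqP cov _ _] := L_part.2.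
have : x \in finset.cover (L @: finset.setT) by rewrite cov inE.
by case/bigcupP => _ /imsetP[i _ ->] xi; exists i.
Qed.

Lemma block_uniq x i j : x \in L i -> x \in L j -> i = j.
Proof.
move=> xi xj; have /and3P[_ triv _] := L_part.2; apply: L_part.1.
apply/eqP; apply: contraT => ij.
have /finset.trivIsetP/(_ (L i) (L j)) := triv.
rewrite !imset_f ?inE// => /(_ isT isT ij).
by rewrite disjoint_subset => /fintype.subsetP/(_ x xi); rewrite inE xj.
Qed.

Lemma blocks_eq x y i : x \in L i -> (blocks L y == blocks L x) = (y \in L i).
Proof.
move=> xi; apply/eqP/idP => [/finset.setP/(_ i)|yi].
  by rewrite !finset.inE xi.
apply/finset.setP => j; rewrite !finset.inE; apply/idP/idP => h.
  by rewrite (block_uniq h yi).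
by rewrite (block_uniq h xi).
Qed.

Lemma meso_eqP s t :
  meso R L s = meso R L t <->
  forall i, \sum_(x in L i) spin R (s x) = \sum_(x in L i) spin R (t x).
Proof.
split=> [/rowP st i|st]; last by apply/rowP => i; rewrite !mxE st.
have := st i; rewrite !mxE; apply: mulfI.
by rewrite invr_eq0 N_neq0.
Qed.

Lemma block_sum_flip s x i :
  \sum_(z in L i) spin R (flip s x z) =
  \sum_(z in L i) spin R (s z) - (if x \in L i then 2 * spin R (s x) else 0).
Proof.
case: ifPn => xi; last first.
  rewrite subr0; apply: eq_bigr => z zi; rewrite flipE.
  by case: eqP => // zx; rewrite -zx zi in xi.
rewrite (bigD1 x)//= [in RHS](bigD1 x)//= flipE eqxx.
rewrite (eq_bigr (fun z => spin R (s z))); last first.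
  by move=> z /andP[_ /negbTE zx]; rewrite flipE zx.
by rewrite /spin; case: (s x) => /=; ring.
Qed.

Lemma meso_flip s t x y :
  meso R L s = meso R L t -> s x = t y -> blocks L x = blocks L y ->
  meso R L (flip s x) = meso R L (flip t y).
Proof.
move=> /meso_eqP st sx /finset.setP xy; apply/meso_eqP => i.
by rewrite !block_sum_flip st sx; have := xy i; rewrite !finset.inE => ->.
Qed.

Lemma meso_flip_neq s x : meso R L (flip s x) <> meso R L s.
Proof.
have [i xi] := block_of x.
move=> /meso_eqP/(_ i); rewrite block_sum_flip xi => /eqP.
rewrite addrC -subr_eq0 addrK oppr_eq0 mulf_eq0 pnatr_eq0 /=.
by rewrite /spin; case: (s x) => /=; rewrite ?oppr_eq0 oner_eq0.
Qed.

(** Equal sums of spins over a block mean equally many sites where only s is up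
    and where only t is up. *)
Lemma disagree_count s t i :
  meso R L s = meso R L t ->
  #|[pred x | [&& x \in L i, s x & ~~ t x]]| =
  #|[pred x | [&& x \in L i, t x & ~~ s x]]|.
Proof.
move=> /meso_eqP/(_ i)/eqP; rewrite -subr_eq0 -sumrB => /eqP h.
apply/eqP; rewrite -(eqr_nat R) -subr_eq0 -!sum1_card !natr_sum.
rewrite -(inj_eq (mulfI (_ : 2 != 0 :> R))) ?pnatr_eq0// mulr0 -[X in _ == X]h.
rewrite big_mkcond/= [X in _ - X]big_mkcond/= -sumrB mulr_sumr.
rewrite [X in _ == X]big_mkcond /=; apply/eqP/eq_bigr => x _.
rewrite !inE; case: (x \in L i) => /=; last by ring.
by rewrite /spin; case: (s x); case: (t x) => /=; ring.
Qed.

(** A permutation carrying the keys of (s, t) to those of (t, s) fixes the sites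
    where s and t agree, since their key is the site itself, and sends any other
    site to one of the same block at which t has the value that s has here. *)
Definition matching_key s t x : 'I_N + ({set 'I_k} * bool) :=
  if s x == t x then inl x else inr (blocks L x, s x).

Lemma matching_key_count s t (v : 'I_N + ({set 'I_k} * bool)) :
  meso R L s = meso R L t ->
  #|[pred x | matching_key s t x == v]| = #|[pred x | matching_key t s x == v]|.
Proof.
move=> st; case: v => [z|[K b]].
  apply: eq_card => x; rewrite !inE /matching_key (eq_sym (t x)).
  by case: ifP.
have [[x xK]|noK] := pselect (exists x, blocks L x = K); last first.
  rewrite !eq_card0// => x; rewrite !inE /matching_key; case: ifP => // _;
  by apply/eqP => -[/esym e _]; apply: noK; exists x.
have [i xi] := block_of x.
have keyE s' t' y : (matching_key s' t' y == inr (K, b)) =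
    [&& y \in L i, s' y == b & t' y != b].
  rewrite /matching_key -xK.
  case: ifPn => [/eqP ->|st'].
    by rewrite andbN andbF.
  rewrite (_ : (inr _ == inr _ :> 'I_N + ({set 'I_k} * bool)) =
     (blocks L y == blocks L x) && (s' y == b))//.
  rewrite (blocks_eq _ xi); congr (_ && _).
  by move: st'; case: (s' y); case: (t' y); case: b.
transitivity #|[pred y | [&& y \in L i, s y == b & t y != b]]|.
  by apply: eq_card => y; rewrite !inE keyE.
transitivity #|[pred y | [&& y \in L i, t y == b & s y != b]]|; last first.
  by apply: eq_card => y; rewrite !inE keyE.
have h := if b return if b then _ else _ then disagree_count i st
  else disagree_count i (esym st).
by case: b {keyE} h => h; (etransitivity; first (etransitivity; last exact: h));
  apply: eq_card => y; rewrite !inE; case: (y \in L i); case: (s y); case: (t y).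
Qed.

(** The coupled moves: when s flips x, t flips pi x. These are flips of equal
    spins in the same block, so the magnetizations remain equal. *)
Lemma matching s t : meso R L s = meso R L t ->
  exists pi : 'S_N, forall x,
    [/\ s x = t (pi x), blocks L (pi x) = blocks L x,
        x \notin disagree s t -> pi x = x
      & x \in disagree s t -> pi x \in disagree s t].
Proof.
move=> st; have [pi piE] := fiber_perm (fun v => matching_key_count v st).
exists pi => x.
have := piE x; rewrite /matching_key !finset.inE.
case: ifPn => [/eqP e|e]; case: ifPn => [/eqP e'|e'] //.
  by case=> ->; rewrite e' eqxx; split.
by case=> -> <-; split=> //; rewrite eq_sym.
Qed.

Lemma disagree_flip_sub s t x y : s x = t y ->
  (x \notin disagree s t -> y = x) ->
  (x \in disagree s t -> y \in disagree s t) ->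
  disagree (flip s x) (flip t y) \subset disagree s t.
Proof.
move=> sx yx yD; apply/fintype.subsetP => z; rewrite !finset.inE !flipE.
have [xD|xD] := boolP (x \in disagree s t).
  have := yD xD; move: xD; rewrite !finset.inE => xD y'D.
  by have [->|_] := eqVneq z x; last have [->|_] := eqVneq z y.
rewrite (yx xD); case: (z =P x) => // ->.
by move: xD; rewrite !finset.inE negbK => /eqP ->; rewrite eqxx.
Qed.

(** Both x and y stop disagreeing: at x only s has changed, and at y only t has
    (x = y is impossible, as s x = t y while s and t differ at x). *)
Lemma disagree_flip_lt s t x y : s x = t y ->
  x \in disagree s t -> y \in disagree s t ->
  (#|disagree (flip s x) (flip t y)| < #|disagree s t|)%N.
Proof.
move=> sx xD yD; apply/proper_card/properP; split.
  by apply: disagree_flip_sub => //; rewrite xD.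
exists x => //; move: xD; rewrite !finset.inE !flipE eqxx negbK => sxt.
have [xy|_] := eqVneq x y; first by move: sxt; rewrite {2}xy -sx eqxx.
by move: sxt; case: (s x); case: (t x).
Qed.

End Matching.

(** * Consequences of the hypotheses on the dynamics *)

(** A block of L is the disjoint union of the blocks of L' that it contains. *)
Lemma refines_meso (R : realType) (N k k' : nat) (L : 'I_k -> {set 'I_N})
    (L' : 'I_k' -> {set 'I_N}) (s t : config N) :
  (0 < N)%N -> is_partition L -> is_partition L' -> refines L' L ->
  meso R L' s = meso R L' t -> meso R L s = meso R L t.
Proof.
move=> N0 pL pL' ref /(meso_eqP _ _ N0) st; apply/(meso_eqP _ _ N0) => i.
have split_sum (F : 'I_N -> R) : \sum_(x in L i) F x =
    \sum_(j | L' j \subset L i) \sum_(x in L' j) F x.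
  rewrite (eq_bigr (fun x => \sum_(j | x \in L' j) F x)); last first.
    move=> x _; have [j xj] := block_of pL' x.
    rewrite (bigD1 j)//= big1 ?addr0// => j' /andP[xj' /eqP []].
    exact: block_uniq pL' _ _ _ xj' xj.
  rewrite (exchange_big_dep xpredT)//= [RHS]big_mkcond/=; apply: eq_bigr => j _.
  case: ifPn => [/fintype.subsetP ji|ji].
    by apply: eq_bigl => x; rewrite andb_idl//; exact: ji.
  rewrite big1// => x /andP[xi xj]; have [i' ii'] := ref j.
  have xi' := fintype.subsetP ii' _ xj.
  by rewrite (block_uniq pL xi xi') ii' in ji.
by rewrite !split_sum; apply: eq_bigr => j _; exact: st.
Qed.

Section Rates.
Context (R : realType) (N : nat) (q : 'I_N -> bool -> config N -> R).
Context (alpha : R) (mu : config N -> R).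
Implicit Types (s t : config N) (x y : 'I_N).
Context (N_gt0 : (0 < N)%N) (q_prob : update_probabilities q).
Context (q_le : forall x b s, q x b s <= alpha) (alpha_lt1 : alpha < 1).

Lemma rate_le1 x s : rate q x s <= 1.
Proof. by apply: (le_trans (q_le _ _ _)); exact: ltW. Qed.

Lemma rate_ge x s : 1 - alpha <= rate q x s.
Proof.
by have := q_le x (s x) s; rewrite (q_stay q_prob); lra.
Qed.

Lemma rate_gt0 x s : 0 < rate q x s.
Proof. by apply: (lt_le_trans _ (rate_ge x s)); rewrite subr_gt0. Qed.

Lemma trans_flip_gt0 s x : 0 < trans q s (flip s x).
Proof. by rewrite (trans_flip q_prob) mulr_gt0 ?rate_gt0// invr_gt0 ltr0n. Qed.

(** The flip graph on configurations is connected. *)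
Lemma flip_path (Q : config N -> Prop) (s0 : config N) :
  Q s0 -> (forall s x, Q (flip s x) -> Q s) -> forall s, Q s.
Proof.
move=> Q0 Qflip s; move: {2}#|_| (erefl #|disagree s s0|) => n.
elim: n s => [|n IHn] s sn.
  suff -> : s = s0 by [].
  apply/ffunP => x; apply/eqP; apply: contraT => sx.
  by have := card0_eq sn x; rewrite !finset.inE sx.
have [x xD] : exists x, x \in disagree s s0 by apply/card_gt0P; rewrite sn.
apply: (Qflip s x); apply: IHn; move: sn; rewrite (cardsD1 x) xD => -[<-].
apply: eq_card => y; move: xD; rewrite !finset.inE flipE => xD.
have [->|//] := eqVneq y x.
by move: xD; case: (s x); case: (s0 x).
Qed.

Hypothesis mu_prob : prob_mass mu.
Hypothesis mu_rev : reversible (trans q) mu.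

(** Reversibility carries positivity of mu along the flip graph, whose edges all
    have positive transition probability because alpha < 1. *)
Lemma mu_gt0 s : 0 < mu s.
Proof.
have [s0 mu0] : exists s0, 0 < mu s0.
  apply: contrapT => /forallNP mu0; have := mu_prob.2.
  rewrite big1 => [/eqP|s' _]; first by rewrite eq_sym oner_eq0.
  apply/eqP; rewrite eq_le mu_prob.1 andbT leNgt; exact/negP/mu0.
move: s; apply: (flip_path (Q := fun s => 0 < mu s) mu0) => s x mux.
have := mu_rev s (flip s x).
have : 0 < mu (flip s x) * trans q (flip s x) s.
  rewrite mulr_gt0//.
  suff {2}<- : flip (flip s x) x = s by exact: trans_flip_gt0.
  by apply/ffunP => y; rewrite !flipE; case: eqP => // ->; rewrite eqxx negbK.
move=> + muE; rewrite -muE pmulr_lgt0//; exact: trans_flip_gt0.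
Qed.

Context (k : nat) (L : 'I_k -> {set 'I_N}) (L_part : is_partition L).

Lemma flips_into_level s (v : 'rV[R]_k) : v <> meso R L s ->
  #|finset.finset (fun s' => (s' \in level L v) && (0 < trans q s s')%R)| =
  #|[pred z | meso R L (flip s z) == v]|.
Proof.
move=> vs; rewrite -(card_imset _ (@flip_inj N s)).
apply: eq_card => s'; rewrite !finset.inE; apply/andP/imsetP.
  move=> [/eqP s'v ps]; have [|x s'E] := trans_gt0_flip q_prob ps.
    by apply: contra_notN vs => /eqP <-; rewrite s'v.
  by exists x => //; rewrite inE -s'E s'v.
by move=> [x]; rewrite inE => /eqP xv ->; rewrite xv eqxx trans_flip_gt0.
Qed.

(** The matching permutation maps the sites whose flip leads from s to level v
    onto those whose flip leads from t to level v. *)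
Lemma flips_into_level_eq s t (v : 'rV[R]_k) : meso R L s = meso R L t ->
  #|[pred z | meso R L (flip s z) == v]| = #|[pred z | meso R L (flip t z) == v]|.
Proof.
move=> st; have [pi piP] := matching N_gt0 L_part st.
rewrite -!sum1_card [RHS](reindex_inj (@perm_inj _ pi)) /=.
apply: eq_bigl => z; rewrite !inE; have [sz bz _ _] := piP z.
by rewrite (meso_flip N_gt0 st sz) ?bz.
Qed.

(** Both flips go from the same level to the same level, so (A.1) compares both
    rates, up to factors 1 + e and 1 - e, with the same mesoscopic rate divided
    by the same number of available flips; (1 + e) / (1 - e) is at most
    1 + 4 e when e is at most 1/2. *)
Lemma rate_ratio (e : R) s t x y :
  assumption_A1 L mu (trans q) e -> 0 <= e -> e <= 1 / 2 ->
  meso R L s = meso R L t -> meso R L (flip s x) = meso R L (flip t y) ->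
  rate q x s <= (1 + 4 * e) * rate q y t.
Proof.
move=> A1 e0 e12 st sxty.
set v := meso R L s; set v' := meso R L (flip s x).
have lev s' : s' \in level L (meso R L s') by rewrite finset.inE.
have mass_gt0 : 0 < meso_mass L mu v.
  rewrite /meso_mass (bigD1 s)//= ltr_pwDl ?mu_gt0//.
  by rewrite sumr_ge0// => s' _; exact/ltW/mu_gt0.
have r_gt0 : 0 < meso_rate L mu (trans q) v v'.
  rewrite /meso_rate mulr_gt0 ?invr_gt0//.
  have term_ge0 (s' s'' : config N) : 0 <= mu s' * trans q s' s''.
    by rewrite mulr_ge0 ?(ltW (mu_gt0 _))// trans_ge0.
  rewrite (bigD1 s)//= ltr_pwDl//; last first.
    by do 2 (rewrite sumr_ge0// => ? _).
  rewrite (bigD1 (flip s x))//= ltr_pwDl ?sumr_ge0//.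
  by rewrite mulr_gt0 ?mu_gt0// trans_flip_gt0.
have Gs : Gamma L v by exists s.
have Gsx : Gamma L v' by exists (flip s x).
have vt : t \in level L v by rewrite /v st.
have v't : flip t y \in level L v' by rewrite /v' sxty.
have Hs := A1 _ _ Gs Gsx r_gt0 _ _ (lev s) (lev _) (trans_flip_gt0 s x).
have Ht := A1 _ _ Gs Gsx r_gt0 _ _ vt v't (trans_flip_gt0 t y).
rewrite flips_into_level in Hs; last exact: meso_flip_neq.
rewrite flips_into_level in Ht; last by rewrite /v' sxty; exact: meso_flip_neq.
rewrite -(flips_into_level_eq _ st) in Ht.
set c : R := #|_|%:R in Hs Ht.
have c_gt0 : 0 < c by rewrite ltr0n; apply/card_gt0P; exists x; rewrite inE.
set r := meso_rate _ _ _ _ _ in r_gt0 Hs Ht.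
move: Hs Ht; rewrite !(trans_flip q_prob) !ler_norml => /andP[_ Hs] /andP[Ht _].
move: Hs; rewrite lerBlDl ler_pdivrMr// => Hs.
move: Ht; rewrite lerBrDl ler_pdivlMr// => Ht.
set a := rate q x s in Hs *; set b := rate q y t in Ht *.
have b0 : 0 < b by exact: rate_gt0.
have cN : 0 < N%:R^-1 * c :> R by rewrite mulr_gt0// invr_gt0 ltr0n.
clearbody r c a b.
have ha : a * (N%:R^-1 * c) <= (1 + e) * r by rewrite mulrCA mulrA.
have hb : (1 - e) * r <= b * (N%:R^-1 * c) by rewrite mulrCA mulrA.
have {}ha : a * (1 - e) * (N%:R^-1 * c) <= (1 + e) * b * (N%:R^-1 * c).
  rewrite mulrAC; apply: (le_trans (ler_wpM2r _ ha)); first by lra.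
  by rewrite -!mulrA ler_wpM2l//; [lra|rewrite mulrC].
move: ha; rewrite ler_pM2r// => ha.
have e1 : 0 < 1 - e by lra.
rewrite -(ler_pM2r e1); apply: (le_trans ha).
rewrite mulrAC ler_pM2r//; nra.
Qed.

End Rates.

(** * An a priori bound *)

Section OffTarget.
Context (R : realType) (N : nat) (q : 'I_N -> bool -> config N -> R).
Context (alpha : R).
Implicit Types (s t : config N) (x y : 'I_N).
Context (N_gt0 : (0 < N)%N) (q_prob : update_probabilities q).
Context (q_le : forall x b s, q x b s <= alpha) (alpha_lt1 : alpha < 1).
Context (alpha_ge0 : 0 <= alpha).
Context (B : {set config N}).

Let rate_lb := rate_ge q_prob q_le.

(** A lower bound for the probability of reaching, in d steps, a configuration
    that differs at d sites: they may be flipped in any order, and each flip has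
    probability at least (1 - alpha) / N. *)
Definition reach_prob (d : nat) : R := d`!%:R * ((1 - alpha) / N%:R) ^+ d.

Lemma reach_probS d : reach_prob d.+1 = d.+1%:R * ((1 - alpha) / N%:R) * reach_prob d.
Proof. by rewrite /reach_prob factS natrM exprS; ring. Qed.

Lemma reach_prob0 : reach_prob 0 = 1.
Proof. by rewrite /reach_prob expr0 mulr1. Qed.

Lemma reach_prob_gt0 d : 0 < reach_prob d.
Proof.
by rewrite mulr_gt0 ?ltr0n ?fact_gt0// exprn_gt0// divr_gt0 ?ltr0n// subr_gt0.
Qed.

Lemma reach_rate_le1 d : (d <= N)%N -> d%:R * ((1 - alpha) / N%:R) <= 1 :> R.
Proof.
move=> dN; rewrite mulrCA; apply: mulr_ile1.
- by rewrite subr_ge0 ltW.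
- by rewrite divr_ge0.
- by rewrite lerBlDl lerDr.
- by rewrite ler_pdivrMr ?ltr0n// mul1r ler_nat.
Qed.

Lemma reach_prob_anti d d' : (d <= d' <= N)%N -> reach_prob d' <= reach_prob d.
Proof.
move=> /andP[dd' d'N]; elim: d' dd' d'N => [|d' IH].
  by rewrite leqn0 => /eqP ->.
rewrite leq_eqVlt => /predU1P[->//|]; rewrite ltnS => dd' d'N.
apply: le_trans (IH dd' (ltnW d'N)); rewrite reach_probS.
by rewrite ler_piMl ?(ltW (reach_prob_gt0 _))// reach_rate_le1.
Qed.

Lemma disagree_flip s t x : x \in disagree s t ->
  #|disagree s t| = #|disagree (flip s x) t|.+1.
Proof.
move=> xD; rewrite (cardsD1 x) xD add1n; congr _.+1; apply: eq_card => y.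
move: xD; rewrite !finset.inE flipE => xD; have [->|//] := eqVneq y x.
by move: xD; case: (s x); case: (t x).
Qed.

(** From every configuration a fixed point b of B is reached within N steps with
    probability at least reach_prob N, and f vanishes there; hence
    max f <= N + (1 - reach_prob N) max f. The induction on the distance d to b
    is the version of this argument in which paths need not be mentioned. *)
Lemma subsolution_bound (f : config N -> R) :
  B != finset.set0 -> (forall s, 0 <= f s) -> (forall s, s \in B -> f s = 0) ->
  (forall s, s \notin B -> f s <= 1 + average (trans q) f s) ->
  forall s, f s <= N%:R / reach_prob N.
Proof.
move=> /set0Pn[b bB] f_ge0 fB fsub s0.
have [sm _ f_le] : extremum_spec >=%R xpredT f [arg max_(s > b) f s]%O.
  exact: arg_maxP.
set M := f sm in f_le *; have {}f_le s : f s <= M by exact: f_le.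
have M_ge0 : 0 <= M by exact: f_ge0.
have claim d s : (#|disagree s b| = d)%N -> f s <= d%:R + (1 - reach_prob d) * M.
  have card_leN (A : {set 'I_N}) : (#|A| <= N)%N.
    by rewrite -[X in (_ <= X)%N]card_ord max_card.
  elim: d s => [|d IH] s sd.
    have -> : s = b.
      apply/ffunP => x; apply/eqP; apply: contraT => sx.
      by have := card0_eq sd x; rewrite !finset.inE sx.
    by rewrite fB// reach_prob0 subrr mul0r addr0.
  have dN : (d.+1 <= N)%N by rewrite -sd.
  have [sB|sB] := boolP (s \in B).
    rewrite fB// addr_ge0// mulr_ge0// subr_ge0.
    have : reach_prob d.+1 <= reach_prob 0 by apply: reach_prob_anti.
    by rewrite reach_prob0.
  apply: (le_trans (fsub _ sB)).
  have flipM x : x \in disagree s b ->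
      (1 - alpha) * (reach_prob d * M - d%:R) <= rate q x s * (M - f (flip s x)).
    move=> xD; have := disagree_flip xD; rewrite sd => -[/esym/IH fx].
    apply: (@le_trans _ _ ((1 - alpha) * (M - f (flip s x)))).
      by apply: ler_wpM2l; [rewrite subr_ge0 ltW|lra].
    by apply: ler_wpM2r; [rewrite subr_ge0 f_le|exact: rate_lb].
  have avg : average (trans q) f s <=
      M - N%:R^-1 * (d.+1%:R * ((1 - alpha) * (reach_prob d * M - d%:R))).
    rewrite (averageE q_prob).
    have -> : M - N%:R^-1 * (d.+1%:R * ((1 - alpha) * (reach_prob d * M - d%:R))) =
        N%:R^-1 * (N%:R * M - d.+1%:R * ((1 - alpha) * (reach_prob d * M - d%:R))).
      by rewrite [RHS]mulrBr mulKf// N_neq0.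
    rewrite ler_wpM2l ?invr_ge0//.
    have hold : (N%:R - \sum_(x < N) rate q x s) * f s <=
        (N%:R - \sum_(x < N) rate q x s) * M.
      rewrite ler_wpM2l ?f_le// subr_ge0 -[leRHS](mulr1) mulrC mulr_natr.
      rewrite -[X in _ <= _ *+ X]card_ord -sumr_const ler_sum// => x _.
      exact: rate_le1 q_le alpha_lt1 _ _.
    apply: (le_trans (lerD (lexx _) hold)).
    have : d.+1%:R * ((1 - alpha) * (reach_prob d * M - d%:R)) <=
        \sum_(x < N) rate q x s * (M - f (flip s x)).
      rewrite -sd mulr_natl -sumr_const big_mkcond/= ler_sum// => x _.
      case: ifPn => xD; first exact: flipM.
      rewrite mulr_ge0 ?subr_ge0 ?f_le//.
      by rewrite (le_trans _ (rate_lb x s))// subr_ge0 ltW.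
    under eq_bigr do rewrite mulrBr.
    by rewrite sumrB -mulr_suml; lra.
  apply: (le_trans (lerD (lexx _) avg)).
  have := reach_rate_le1 dN.
  rewrite reach_probS -natr1; set r := reach_prob d.
  set bt := (1 - alpha) / N%:R => btd.
  rewrite (_ : N%:R^-1 * _ = ((d%:R + 1) * bt) * (r * M - d%:R)); last first.
    by rewrite /bt; ring.
  by have := ler0n R d; set D := d%:R in btd *; nra.
apply: (le_trans (f_le s0)); rewrite ler_pdivlMr ?reach_prob_gt0//.
have := claim _ _ (erefl #|disagree sm b|); rewrite -/M.
have dN : (#|disagree sm b| <= N)%N by rewrite -[X in (_ <= X)%N]card_ord max_card.
have : M * reach_prob N <= M * reach_prob #|disagree sm b|.
  by rewrite ler_wpM2l// reach_prob_anti// dN leqnn.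
have : #|disagree sm b|%:R <= N%:R :> R by rewrite ler_nat.
by lra.
Qed.

End OffTarget.

(** * A Harnack inequality on level sets of the magnetization *)

Section Harnack.
Context (R : realType) (N : nat) (q : 'I_N -> bool -> config N -> R).
Context (alpha rho : R) (k : nat) (L : 'I_k -> {set 'I_N}).
Implicit Types (s t : config N) (x y : 'I_N).
Context (N_gt0 : (0 < N)%N) (q_prob : update_probabilities q).
Context (q_le : forall x b s, q x b s <= alpha) (alpha_lt1 : alpha < 1).
Context (L_part : is_partition L) (A2 : assumption_A2 L q).
Context (rho_ge1 : 1 <= rho)
  (ratio : forall s t x y, meso R L s = meso R L t ->
     meso R L (flip s x) = meso R L (flip t y) ->
     rate q x s <= rho * rate q y t).

(** The factor lost by the coupling: rho for each flip of a disagreeing site (at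
    most d of them), and expR ((rho - 1) / (1 - alpha) * (j / N)) for a step at
    which j sites disagree, where u bounds the sum of the j over the run. *)
Definition coupling_cost (d : nat) (u : R) : R :=
  rho ^+ d * expR ((rho - 1) / (1 - alpha) * (u / N%:R)).

(** A bound for the probability that the configurations have not met when the
    numbers of disagreeing sites add up to u. Each step with j of them removes
    one with probability at least (1 - alpha) j / N and lowers the remaining
    budget u by j, which makes meeting_failure j u a supermartingale. *)
Definition meeting_failure (d : nat) (u : R) : R :=
  2 ^+ d * expR (- ((1 - alpha) / 2 * (u / N%:R))).

Context (B : {set config N}).
Context (B_level : forall s t, meso R L s = meso R L t -> (s \in B) = (t \in B)).
Context (w : config N -> R) (W kap : R).
Context (w_ge0 : forall s, 0 <= w s) (w_le : forall s, w s <= W).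
Context (w_B : forall s, s \in B -> w s = 0) (kap_ge0 : 0 <= kap).
Context (w_sub : forall s, s \notin B -> w s <= 1 + average (trans q) w s).
Context (w_super : forall s, s \notin B -> average (trans q) w s <= w s + kap).

Let NR_gt0 : 0 < N%:R :> R. Proof. by rewrite ltr0n. Qed.
Let alpha1 : 0 < 1 - alpha. Proof. by rewrite subr_gt0. Qed.
Let rho0 : 0 <= rho. Proof. exact: le_trans rho_ge1. Qed.

Let expR_ge1 (x : R) : 0 <= x -> 1 <= expR x.
Proof. by move=> x0; rewrite -expR0 ler_expR. Qed.

Lemma coupling_cost_ge0 d u : 0 <= coupling_cost d u.
Proof. by rewrite mulr_ge0 ?exprn_ge0 ?expR_ge0. Qed.

Lemma coupling_cost_le d d' u : (d <= d')%N -> coupling_cost d u <= coupling_cost d' u.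
Proof. by move=> dd'; rewrite ler_wpM2r ?expR_ge0// ler_weXn2l. Qed.

Lemma coupling_cost_add d u v : coupling_cost d (u + v) =
  coupling_cost d u * expR ((rho - 1) / (1 - alpha) * (v / N%:R)).
Proof. by rewrite /coupling_cost -[RHS]mulrA -expRD; congr (_ * expR _); ring. Qed.

Lemma coupling_cost_le_add d u v : 0 <= v ->
  coupling_cost d u <= coupling_cost d (u + v).
Proof.
move=> v0; rewrite coupling_cost_add ler_peMr ?coupling_cost_ge0//.
by rewrite expR_ge1// mulr_ge0 ?divr_ge0// ?subr_ge0// ltW.
Qed.

Lemma coupling_cost_ge1 d u : 0 <= u -> 1 <= coupling_cost d u.
Proof.
move=> u0; rewrite mulr_ege1// ?exprn_ege1//.
by rewrite expR_ge1// mulr_ge0 ?divr_ge0// ?subr_ge0// ltW.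
Qed.

Lemma meeting_failure_ge0 d u : 0 <= meeting_failure d u.
Proof. by rewrite mulr_ge0 ?exprn_ge0 ?expR_ge0. Qed.

Lemma meeting_failure_le d d' u : (d <= d')%N ->
  meeting_failure d u <= meeting_failure d' u.
Proof. by move=> dd'; rewrite ler_wpM2r ?expR_ge0// ler_weXn2l// ler1n. Qed.

Lemma meeting_failureS d u : meeting_failure d.+1 u = 2 * meeting_failure d u.
Proof. by rewrite /meeting_failure exprS mulrA. Qed.

Lemma meeting_failure_add d u v : meeting_failure d (u + v) =
  meeting_failure d u * expR (- ((1 - alpha) / 2 * (v / N%:R))).
Proof. by rewrite /meeting_failure -[RHS]mulrA -expRD; congr (_ * expR _); field; rewrite gt_eqF. Qed.

(** When the budget u cannot pay for one more step the bound on the probability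
    of not having met is trivial. *)
Lemma meeting_failure_ge1 d u : (0 < d <= N)%N -> 0 <= alpha -> u <= d%:R ->
  1 <= meeting_failure d u.
Proof.
move=> /andP[d0 dN] a0 ud.
have y2 : (1 - alpha) / 2 * (u / N%:R) <= 1 / 2.
  have uN : u / N%:R <= 1.
    by rewrite ler_pdivrMr// mul1r (le_trans ud)// ler_nat.
  by move: alpha1 => ?; nra.
have two : 2 <= 2 ^+ d :> R by rewrite -[leLHS]expr1 ler_weXn2l// ler1n.
have := expR_ge1Dx (- ((1 - alpha) / 2 * (u / N%:R))).
rewrite /meeting_failure; nra.
Qed.

(** This is where (A.2) enters: moves at agreeing sites are coupled without any
    loss, so that the total loss is governed by the disagreeing sites alone. *)
Lemma rate_agree s t x : meso R L s = meso R L t -> x \notin disagree s t ->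
  rate q x s = rate q x t.
Proof.
move=> st; rewrite finset.inE negbK => /eqP sx.
by rewrite /rate sx; apply: A2.
Qed.

(** The holding probabilities differ only through the rates at the disagreeing
    sites, that is by at most (rho - 1) d / N, and the smaller one is at least
    1 - alpha. *)
Lemma hold_ratio s t : meso R L s = meso R L t ->
  N%:R - \sum_(x < N) rate q x s <=
  (N%:R - \sum_(x < N) rate q x t) *
    expR ((rho - 1) / (1 - alpha) * (#|disagree s t|%:R / N%:R)).
Proof.
move=> st; have [pi piP] := matching N_gt0 L_part st.
set d : R := #|_|%:R; set g := (rho - 1) / (1 - alpha) * _.
set As := \sum_(x < N) rate q x s; set At := \sum_(x < N) rate q x t.
have AtE : At = \sum_(x < N) rate q (pi x) t by exact: reindex_inj perm_inj.
have diff : At - As <= (rho - 1) * d.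
  rewrite AtE /As -sumrB /d mulr_natr -sumr_const [leRHS]big_mkcond/=.
  apply: ler_sum => x _; have [sx bx nDx Dx] := piP x.
  case: ifPn => xD; last by rewrite nDx// (rate_agree st xD) subrr.
  have := ratio (esym st) (esym (meso_flip N_gt0 st sx (esym bx))).
  have := rate_le1 q_le alpha_lt1 x s.
  have := rate_gt0 q_prob q_le alpha_lt1 x s.
  by move: rho_ge1 => ?; nra.
have At_ge : N%:R * (1 - alpha) <= N%:R - At.
  rewrite lerBrDl -lerBrDr -{1}[N%:R]mulr1 -mulrBr opprB addrC subrK.
  rewrite mulr_natl -[X in _ *+ X]card_ord -sumr_const ler_sum// => x _.
  exact: q_le.
have g1 : 1 + g <= expR g by exact: expR_ge1Dx.
have gE : (rho - 1) * d = N%:R * (1 - alpha) * g.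
  by rewrite /g; field; rewrite !gt_eqF.
have g0 : 0 <= g by rewrite !mulr_ge0 ?invr_ge0 ?subr_ge0// ltW.
have At0 : 0 <= N%:R - At by rewrite (le_trans _ At_ge)// mulr_ge0// ltW.
apply: (@le_trans _ _ ((N%:R - At) * (1 + g))); last by rewrite ler_wpM2l.
move: (ler_wpM2r g0 At_ge); rewrite -gE; lra.
Qed.

(** One step of the coupling, at the price of d = #|disagree s t| units of budget.
    Flips are compared with the flips of the matched sites and holding with
    holding; passing from u' to u' + d in coupling_cost covers the losses
    of these comparisons, and in meeting_failure it records the chance that a
    disagreement is removed. *)
Lemma step_pair s t (u' : R) : 0 <= u' -> 
  meso R L s = meso R L t -> s \notin B ->
  (forall s' t', meso R L s' = meso R L t' ->
     w s' <= u' + coupling_cost #|disagree s' t'| u' * (w t' + u' * kap)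
             + W * meeting_failure #|disagree s' t'| u') ->
  w s <= (u' + 1) + coupling_cost #|disagree s t| (u' + #|disagree s t|%:R)
           * (w t + (u' + 1) * kap)
         + W * meeting_failure #|disagree s t| (u' + #|disagree s t|%:R).
Proof.
move=> u0 st sB IH; have tB : t \notin B by rewrite -(B_level st).
set d := #|disagree s t|.
have W0 : 0 <= W by exact: le_trans (w_ge0 s) (w_le s).
have [pi piP] := matching N_gt0 L_part st.
set b := coupling_cost d (u' + d%:R); set E := meeting_failure d u'.
set Z := w t + u' * kap.
have bE v : (v <= d)%N -> coupling_cost v u' <= b.
  move=> vd; apply: le_trans (coupling_cost_le _ vd) _.
  exact: coupling_cost_le_add.
have u'kap : 0 <= u' * kap by rewrite mulr_ge0.
(* A flip of a disagreeing site leaves at most d - 1 disagreements: this pays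
   one factor rho and halves the bound on the probability of not meeting. *)
have one x : rate q x s * w (flip s x) <=
    rate q x s * u' + b * (rate q (pi x) t * (w (flip t (pi x)) + u' * kap))
    + W * E * (rate q x s - (if x \in disagree s t then rate q x s / 2 else 0)).
  have [sx bx nDx Dx] := piP x.
  have stx : meso R L (flip s x) = meso R L (flip t (pi x)).
    by apply: meso_flip => //; rewrite bx.
  set a := rate q x s; set a' := rate q (pi x) t.
  have a0 : 0 <= a by apply/ltW/(rate_gt0 q_prob q_le).
  have a'0 : 0 <= a' by apply/ltW/(rate_gt0 q_prob q_le).
  set w' := w (flip t (pi x)) + u' * kap.
  have w'0 : 0 <= w' by rewrite addr_ge0.
  have := IH _ _ stx; rewrite -/w'; clearbody w' => IHx.
  apply: (le_trans (ler_wpM2l a0 IHx)).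
  rewrite [a * (_ + _ + _)]mulrDr [a * (_ + _)]mulrDr; set d' := #|disagree (flip s x) _|.
  apply: lerD; first (apply: lerD => //).
    rewrite mulrA [leRHS]mulrA ler_wpM2r//.
    have [xD|xD] := boolP (x \in disagree s t).
      have dd' : (d' < d)%N by apply: disagree_flip_lt => //; exact: Dx.
      have := ratio st stx; rewrite -/a -/a' => aa'.
      apply: (@le_trans _ _ (rho * a' * coupling_cost d' u')).
        by rewrite ler_wpM2r ?coupling_cost_ge0.
      rewrite (_ : _ * _ * _ = coupling_cost d'.+1 u' * a').
        by rewrite ler_wpM2r// bE.
      by rewrite /coupling_cost exprS; ring.
    have -> : a = a' by rewrite /a /a' (nDx xD); exact: rate_agree.
    rewrite mulrC ler_wpM2r// bE// subset_leq_card//.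
    exact: disagree_flip_sub.
  rewrite mulrCA -mulrA ler_wpM2l//.
  case: ifPn => [xD|xD].
    have dd' : (d' < d)%N by apply: disagree_flip_lt => //; exact: Dx.
    have := meeting_failure_le u' dd'; rewrite meeting_failureS -/E.
    have := meeting_failure_ge0 d' u'; nra.
  rewrite subr0 mulrC ler_wpM2r// meeting_failure_le// subset_leq_card//.
  exact: disagree_flip_sub.
set As := \sum_(x < N) rate q x s; set At := \sum_(x < N) rate q x t.
have As_le : 0 <= N%:R - As.
  rewrite subr_ge0 -[leRHS]mulr1 mulrC mulr_natr.
  rewrite -[X in _ <= _ *+ X]card_ord -sumr_const ler_sum// => x _.
  exact: rate_le1 q_le alpha_lt1 _ _.
have hold : (N%:R - As) * w s <=
    (N%:R - As) * u' + b * ((N%:R - At) * Z) + W * E * (N%:R - As).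
  apply: (le_trans (ler_wpM2l As_le (IH _ _ st))); rewrite -/d -/E -/Z.
  have Z0 : 0 <= Z by rewrite addr_ge0.
  clearbody Z; rewrite [_ * (_ + _ + _)]mulrDr [_ * (u' + _)]mulrDr.
  apply: lerD; last by rewrite mulrC.
  apply: lerD => //; rewrite mulrA [leRHS]mulrA ler_wpM2r//.
  rewrite /b coupling_cost_add -mulrA (mulrC _ (coupling_cost _ _)).
  rewrite ler_wpM2l ?coupling_cost_ge0// mulrC; exact: hold_ratio.
set rD := \sum_(x in disagree s t) rate q x s.
have total : N%:R * average (trans q) w s <=
    N%:R * u' + b * (N%:R * (average (trans q) w t + u' * kap))
    + W * E * (N%:R - rD / 2).
  rewrite !(averageE q_prob) mulVKf ?gt_eqF// mulrDr mulVKf ?gt_eqF//.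
  apply: (le_trans (lerD (ler_sum _ (fun x _ => one x)) hold)).
  rewrite !big_split/= -!mulr_sumr -mulr_suml -/As.
  have -> : \sum_(x < N) rate q (pi x) t * (w (flip t (pi x)) + u' * kap) =
      \sum_(y < N) rate q y t * w (flip t y) + At * (u' * kap).
    rewrite /At mulr_suml -big_split/= [RHS](reindex_inj (@perm_inj _ pi)) /=.
    by apply: eq_bigr => x _; rewrite mulrDr.
  have -> : \sum_(x < N) (rate q x s -
      (if x \in disagree s t then rate q x s / 2 else 0)) = As - rD / 2.
    by rewrite sumrB -/As /rD mulr_suml [in RHS]big_mkcond.
  by rewrite -/At /Z le_eqVlt; apply/orP; left; apply/eqP; ring.
have rD_ge : (1 - alpha) * d%:R <= rD.
  by rewrite mulr_natr -sumr_const ler_sum// => x _; exact: rate_ge.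
have fail : E * (N%:R - rD / 2) <= N%:R * meeting_failure d (u' + d%:R).
  rewrite meeting_failure_add -/E mulrCA ler_wpM2l ?meeting_failure_ge0//.
  have := expR_ge1Dx (- ((1 - alpha) / 2 * (d%:R / N%:R))).
  move=> h; apply: le_trans (ler_wpM2l (ltW NR_gt0) h).
  rewrite mulrDr mulr1 mulrN (_ : N%:R * _ = (1 - alpha) * d%:R / 2).
    by lra.
  by field; rewrite gt_eqF.
have b0 : 0 <= b by exact: coupling_cost_ge0.
have avg : average (trans q) w s <= u' + b * (w t + kap + u' * kap)
    + W * meeting_failure d (u' + d%:R).
  rewrite -(ler_pM2l NR_gt0); apply: (le_trans total).
  rewrite [leRHS]mulrDr [N%:R * (u' + _)]mulrDr; apply: lerD.
    apply: lerD => //; rewrite [leRHS]mulrCA ler_wpM2l// ler_wpM2l//.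
    by rewrite lerD2r; exact: w_super.
  by rewrite -mulrA [leRHS]mulrCA ler_wpM2l.
apply: (le_trans (w_sub sB)); apply: (le_trans (lerD (lexx _) avg)).
by rewrite le_eqVlt; apply/orP; left; apply/eqP; ring.
Qed.

(** The coupling is run until the configurations meet or the budget u is spent.
    Each step adds 1 on the side of s (w_sub) and kap on the side of t (w_super);
    if the budget is spent without a meeting, w s is bounded by W. *)
Lemma harnack s t (u : nat) : 0 <= alpha -> meso R L s = meso R L t ->
  w s <= u%:R + coupling_cost #|disagree s t| u%:R * (w t + u%:R * kap)
         + W * meeting_failure #|disagree s t| u%:R.
Proof.
move=> alpha0; elim/ltn_ind: u s t => u IH s t st.
have W0 : 0 <= W by exact: le_trans (w_ge0 s) (w_le s).
have rest0 : 0 <= u%:R + coupling_cost #|disagree s t| u%:R * (w t + u%:R * kap).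
  by rewrite addr_ge0// mulr_ge0 ?coupling_cost_ge0// addr_ge0// mulr_ge0.
have fail0 := mulr_ge0 W0 (meeting_failure_ge0 #|disagree s t| u%:R).
have [sB|sB] := boolP (s \in B); first by rewrite w_B// addr_ge0.
have [d0|d_gt0] := posnP #|disagree s t|.
  have -> : s = t.
    apply/ffunP => x; apply/eqP; apply: contraT => sx.
    by have := card0_eq d0 x; rewrite !finset.inE sx.
  have c1 := coupling_cost_ge1 #|disagree t t| (ler0n R u).
  have := meeting_failure_ge0 #|disagree t t| u%:R; have := w_ge0 t.
  have : 0 <= u%:R * kap by rewrite mulr_ge0.
  have := ler0n R u; nra.
have dN : (#|disagree s t| <= N)%N by rewrite -[X in (_ <= X)%N]card_ord max_card.
have [ud|du] := ltnP u #|disagree s t|.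
  apply: ler_wpDl => //; apply: (le_trans (w_le s)).
  by rewrite ler_peMr// meeting_failure_ge1 ?d_gt0// ler_nat ltnW.
set d := #|disagree s t| in d_gt0 dN du *.
have u'u : (u - d < u)%N by rewrite ltn_subrL d_gt0 (leq_trans d_gt0).
have := step_pair (ler0n R (u - d)) st sB (fun s' t' => IH _ u'u s' t').
rewrite -/d -natrD subnK// => /le_trans; apply.
have u1 : (u - d)%:R + 1 <= u%:R :> R by rewrite natr1 ler_nat.
rewrite lerD2r lerD// ler_wpM2l ?coupling_cost_ge0//.
by rewrite lerD2l ler_wpM2r.
Qed.

End Harnack.

(** * Mean hitting times and the excess over a level *)

Section Potential.
Context (R : realType) (T : finType).
Implicit Types (K p : T -> T -> R) (r f : T -> R) (s : T) (n : nat).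

Definition killed p (D : {set T}) : T -> T -> R :=
  fun s s' => if s' \in D then 0 else p s s'.

(** The n-th partial sum of the potential sum_t K^t r, generated from the left so
    that the fixed point equation of the limit is immediate. *)
Fixpoint green K r n : T -> R :=
  if n is n'.+1 then fun s => r s + average K (green K r n') s else fun=> 0.

Lemma greenS K (r : T -> R) n s :
  green K r n.+1 s = green K r n s + iter n (average K) r s.
Proof.
elim: n s => [|n IH] s.
  by rewrite /= /average big1 ?addr0 ?add0r// => s' _; rewrite mulr0.
rewrite [LHS]/= [X in _ + X](eq_bigr (fun s' => K s s' * green K r n s' +
    K s s' * iter n (average K) r s')); last first.
  by move=> s' _; rewrite -mulrDr -IH.
by rewrite big_split /= addrA.
Qed.

Lemma green_sum K (r : T -> R) n s :
  green K r n s = \sum_(0 <= t < n) iter t (average K) r s.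
Proof.
elim: n => [|n IH]; first by rewrite big_geq.
by rewrite greenS IH big_nat_recr.
Qed.

Section Green.
Context (K : T -> T -> R) (r : T -> R) (M : R).
Context (K_ge0 : forall s s', 0 <= K s s') (r_ge0 : forall s, 0 <= r s).

Lemma green_ge0 n s : 0 <= green K r n s.
Proof.
elim: n s => //= n IH s.
by rewrite addr_ge0// sumr_ge0// => s' _; rewrite mulr_ge0.
Qed.

Lemma green_leS n s : green K r n s <= green K r n.+1 s.
Proof.
elim: n s => [|n IH] s; first exact: green_ge0.
by rewrite [leLHS]/= [leRHS]/= lerD2l ler_sum// => s' _; rewrite ler_wpM2l.
Qed.

Context (green_le : forall n s, green K r n s <= M).

Definition green_lim s : R := lim (green K r n s @[n --> \oo]).

Lemma green_cvg s : green K r n s @[n --> \oo] --> green_lim s.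
Proof.
apply: nondecreasing_is_cvgn.
  by apply/nondecreasing_seqP => n; exact: green_leS.
by exists M => _ [n _ <-]; exact: green_le.
Qed.

(** The partial sums increase and are bounded, and a finite sum is continuous. *)
Lemma green_limE s : green_lim s = r s + average K green_lim s.
Proof.
have c1 : green K r n.+1 s @[n --> \oo] --> green_lim s.
  by have := @green_cvg s; rewrite -(cvg_shiftS (fun n => green K r n s)).
have c2 : green K r n.+1 s @[n --> \oo] --> r s + average K green_lim s.
  apply: cvgD; first exact: cvg_cst.
  apply: cvg_big => [|s' _]; first exact: add_continuous.
  by apply: cvgMl_tmp; exact: green_cvg.
by have := cvg_unique _ c1 c2; apply.
Qed.

Lemma green_lim_ge n s : green K r n s <= green_lim s.
Proof.
apply: (nondecreasing_cvgn_le _ (@green_cvg s)).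
by apply/nondecreasing_seqP => m; exact: green_leS.
Qed.

Lemma green_lim_le (m : R) s : (forall n, green K r n s <= m) -> green_lim s <= m.
Proof.
move=> gm; apply: limr_le; first exact: green_cvg.
by near=> n; exact: gm.
Unshelve. all: by end_near. Qed.

End Green.

Section Excess.
Context (p : T -> T -> R) (p_ge0 : forall s s', 0 <= p s s').
Context (p_sum1 : forall s, \sum_s' p s s' = 1).
Context (S B : {set T}) (SB : forall s, s \in S -> s \notin B).
Context (G H : T -> R) (m delta : R).
Context (G_ge0 : forall s, 0 <= G s)
  (GE : forall s, G s = 1 + average (killed p B) G s).
Context (H_ge0 : forall s, 0 <= H s)
  (HE : forall s, H s = \sum_(b in B) p s b + average (killed p (S :|: B)) H s).
Context (m_le : forall s, s \in S -> m <= G s) (m_ge0 : 0 <= m).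
Context (H_le : forall s, s \in S -> H s <= delta) (delta_ge0 : 0 <= delta).

(** The probability that, starting from s at time 0 included, the chain visits S
    before B, when H s is the probability that from time 1 on B comes first. *)
Definition return_prob s : R :=
  if s \in B then 0 else if s \in S then 1 else 1 - H s.

(** The part of the mean hitting time G not accounted for by returning to S and
    starting there afresh with the minimal value m. *)
Definition excess s : R := (if s \in B then 0 else G s) - m * return_prob s.

Lemma average_return_prob s : average p return_prob s = 1 - H s.
Proof.
rewrite HE /average.
have -> : \sum_(b in B) p s b = \sum_b (if b \in B then p s b else 0).
  exact: big_mkcond.
rewrite -big_split/= -(p_sum1 s) -sumrB; apply: eq_bigr => s' _; rewrite /return_prob /killed finset.in_setU.
have [s'S|s'S] := boolP (s' \in S); last by case: ifP => _ /=; ring.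
by rewrite (negbTE (SB s'S)) /=; ring.
Qed.

Lemma average_off_target s :
  average p (fun s' => if s' \in B then 0 else G s') s = G s - 1.
Proof.
rewrite GE addrC addKr; apply: eq_bigr => s' _.
by rewrite /killed; case: ifP; rewrite ?mulr0 ?mul0r.
Qed.

Lemma excessE s : s \notin B ->
  excess s = 1 + average p excess s - (if s \in S then m * H s else 0).
Proof.
move=> sB; have -> : average p excess s = G s - 1 - m * (1 - H s).
  rewrite -average_off_target -average_return_prob /average mulr_sumr -sumrB.
  by apply: eq_bigr => s' _; rewrite /excess; ring.
by rewrite /excess /return_prob (negbTE sB); case: ifP => _; ring.
Qed.

Lemma excess_target s : s \in B -> excess s = 0.
Proof. by move=> sB; rewrite /excess /return_prob sB; ring. Qed.

(** Off S and B, excess s = 1 + P excess s exceeds the minimum of the excess, so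
    the minimum is attained on S or B, where the sign is clear. *)
Lemma excess_ge0 s : 0 <= excess s.
Proof.
have [s0 _ s0P] : extremum_spec <=%R xpredT excess [arg min_(s' < s) excess s']%O.
  exact: arg_minP.
apply: le_trans (s0P _ isT).
have [s0B|s0B] := boolP (s0 \in B); first by rewrite excess_target.
have [s0S|s0S] := boolP (s0 \in S).
  by rewrite /excess /return_prob (negbTE s0B) s0S mulr1 subr_ge0 m_le.
have : excess s0 <= average p excess s0.
  rewrite -[leLHS]mul1r -(p_sum1 s0) mulr_suml ler_sum// => s' _.
  by rewrite ler_wpM2l ?s0P.
by move: (excessE s0B); rewrite (negbTE s0S) subr0; lra.
Qed.

Lemma excess_sub s : s \notin B -> excess s <= 1 + average p excess s.
Proof.
move=> sB; rewrite {1}(excessE sB) lerBlDr lerDl.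
by case: ifP => // _; rewrite mulr_ge0.
Qed.

(** The excess fails to be superharmonic only on S, where the failure is m times
    the probability of reaching B before returning to S. *)
Lemma excess_super s : s \notin B -> average p excess s <= excess s + m * delta.
Proof.
move=> sB; rewrite (excessE sB).
case: ifP => sS; last by rewrite subr0 -addrA addrCA lerDl addr_ge0// mulr_ge0.
have := ler_wpM2l m_ge0 (H_le sS); lra.
Qed.

(** At a minimizer the excess vanishes and still equals 1 + P excess - m H. It
    says that the minimal mean hitting time is at least 1 / delta, which makes
    additive errors of polynomial size negligible. *)
Lemma min_lower_bound s : s \in S -> G s = m -> 1 <= m * delta.
Proof.
move=> sS Gm; have sB := SB sS.
have : excess s = 0.
  by rewrite /excess /return_prob (negbTE sB) sS Gm mulr1 subrr.
rewrite (excessE sB) sS; have := ler_wpM2l m_ge0 (H_le sS).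
have : 0 <= average p excess s.
  by apply: sumr_ge0 => s' _; rewrite mulr_ge0// excess_ge0.
lra.
Qed.

Lemma return_lower_bound s : s \notin B -> H s <= delta ->
  (1 - delta) * m <= G s.
Proof.
move=> sB Hd; have := excess_ge0 s; rewrite /excess (negbTE sB) subr_ge0.
apply: le_trans; rewrite mulrC ler_wpM2l// /return_prob (negbTE sB).
by case: ifP => _; [rewrite gerBl|rewrite lerD2l lerN2].
Qed.

End Excess.

End Potential.

(** * Comparison of mean hitting times for one system size *)

Section MeanHit.
Context (R : realType) (N : nat) (q : 'I_N -> bool -> config N -> R).
Context (alpha : R).
Context (N_gt0 : (0 < N)%N) (q_prob : update_probabilities q).
Context (q_le : forall x b s, q x b s <= alpha) (alpha_lt1 : alpha < 1).
Context (alpha_ge0 : 0 <= alpha).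
Implicit Types (s t : config N) (B S : {set config N}).

(** The expectation of the hitting time is the sum over t of the probabilities
    that B is avoided up to time t. *)
Definition mean_hit B : config N -> R :=
  green_lim (killed (trans q) B) (fun=> 1).

(** The probability that the first visit to S or B at a positive time is a visit
    to B. *)
Definition escape_prob S B : config N -> R :=
  green_lim (killed (trans q) (S :|: B)) (fun s => \sum_(b in B) trans q s b).

Lemma killed_ge0 (D : {set config N}) s t : 0 <= killed (trans q) D s t.
Proof. by rewrite /killed; case: ifP => // _; exact: trans_ge0. Qed.

Definition crude_bound : R := N%:R / reach_prob N alpha N.

Lemma crude_bound_ge0 : 0 <= crude_bound.
Proof. by rewrite divr_ge0// ltW// reach_prob_gt0. Qed.

(** The partial sums increase, so each of them, set to zero on B, satisfies
    f <= 1 + P f off B. *)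
Lemma mean_hit_green_le B : B != finset.set0 ->
  forall n s, green (killed (trans q) B) (fun=> 1) n s <= 1 + crude_bound.
Proof.
move=> B0 n s; set g := green _ _; pose f s := if s \in B then 0 else g n s.
have gS t : g n.+1 t = 1 + average (trans q) f t.
  congr (_ + _); apply: eq_bigr => t' _; rewrite /f /killed.
  by case: ifP; rewrite ?mul0r ?mulr0.
have g_ge0 : forall m t, 0 <= g m t.
  by move=> m t; apply: green_ge0 => // ? ?; exact: killed_ge0.
have gle t : g n t <= g n.+1 t.
  by apply: green_leS => // ? ?; exact: killed_ge0.
have f_le t : f t <= crude_bound.
  apply: (subsolution_bound N_gt0 q_prob q_le alpha_lt1 alpha_ge0 B0) => t'.
  - by rewrite /f; case: ifP.
  - by rewrite /f => ->.
  - by move=> t'B; rewrite {1}/f (negbTE t'B) -gS.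
apply: (le_trans (gle s)); rewrite gS lerD2l.
rewrite -[leRHS]mul1r -(trans_sum1 N_gt0 q_prob s) mulr_suml ler_sum// => t _.
by rewrite ler_wpM2l// trans_ge0.
Qed.

Lemma mean_hit_ge1 B s : B != finset.set0 -> 1 <= mean_hit B s.
Proof.
move=> B0; have := green_lim_ge (killed_ge0 B) (fun=> ler01) (mean_hit_green_le B0) 1 s.
by rewrite /= /average big1 ?addr0// => s' _; rewrite mulr0.
Qed.

Lemma escape_green_le1 S B n s :
  green (killed (trans q) (S :|: B)) (fun s => \sum_(b in B) trans q s b) n s <= 1.
Proof.
elim: n s => [|n IH] s /=; first exact: ler01.
rewrite -(trans_sum1 N_gt0 q_prob s) /average [X in X + _]big_mkcond -big_split/=.
apply: ler_sum => t _; rewrite /killed finset.in_setU.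
case: (boolP (t \in B)) => tB; first by rewrite orbT mul0r addr0.
rewrite orbF add0r; case: ifP => _; first by rewrite mul0r trans_ge0.
by rewrite ler_piMr// trans_ge0.
Qed.

Context (k : nat) (L : 'I_k -> {set 'I_N}) (rho : R).
Context (L_part : is_partition L) (A2 : assumption_A2 L q).
Context (rho_ge1 : 1 <= rho)
  (ratio : forall s t x y, meso R L s = meso R L t ->
     meso R L (flip s x) = meso R L (flip t y) ->
     rate q x s <= rho * rate q y t).
Context (B : {set config N}) (B_neq0 : B != finset.set0).
Context (B_level : forall s t, meso R L s = meso R L t -> (s \in B) = (t \in B)).

(** The Harnack inequality, between s and a minimizer of mean_hit B on its level
    set S, bounds the excess at s by a multiple of kap = m delta, because the
    excess vanishes at the minimizer; and from t the level S is reached before B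
    with probability at least 1 - delta. *)
Lemma mean_hit_ratio s t (u : nat) (delta : R) :
  s \notin B -> t \notin B -> delta <= 1 ->
  (forall s', s' \in level L (meso R L s) ->
     escape_prob (level L (meso R L s)) B s' <= delta) ->
  escape_prob (level L (meso R L s)) B t <= delta ->
  crude_bound * meeting_failure N alpha N u%:R <= 1 ->
  (1 - delta) * mean_hit B s <=
  (1 + delta * (u%:R + coupling_cost N alpha rho N u%:R * u%:R + 1))
    * mean_hit B t.
Proof.
move=> sB tB delta1; set S := level L _; move=> S_le t_le failure_le1.
have lev s' : (s' \in S) = (meso R L s' == meso R L s) by rewrite finset.inE.
have SB s' : s' \in S -> s' \notin B.
  by rewrite lev => /eqP /B_level ->.
have sS : s \in S by rewrite lev.
set G := mean_hit B; set H := escape_prob S B.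
have p_ge0 := trans_ge0 q_prob; have p_sum1 := trans_sum1 N_gt0 q_prob.
have GE s' : G s' = 1 + average (killed (trans q) B) G s'.
  apply: (green_limE (r := fun=> 1) (killed_ge0 B)) => //.
  exact: mean_hit_green_le.
have G_ge0 s' : 0 <= G s'.
  apply: (@green_lim_ge _ _ _ _ _ (killed_ge0 B) (fun=> ler01) _ 0%N).
  exact: mean_hit_green_le.
have pB_ge0 s' : 0 <= \sum_(b in B) trans q s' b by rewrite sumr_ge0.
have HE s' : H s' = \sum_(b in B) trans q s' b
    + average (killed (trans q) (S :|: B)) H s'.
  apply: (green_limE (killed_ge0 _) pB_ge0); exact: escape_green_le1.
have H_ge0 s' : 0 <= H s'.
  apply: (@green_lim_ge _ _ _ _ _ (killed_ge0 _) pB_ge0 _ 0%N).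
  exact: escape_green_le1.
have [sm smS smP] : extremum_spec <=%R (mem S) G [arg min_(s' < s in S) G s']%O.
  exact: arg_minP.
have {}smS : sm \in S := smS.
set m := G sm.
have m_ge0 : 0 <= m by exact: G_ge0.
have delta_ge0 : 0 <= delta by exact: le_trans (H_ge0 _) (S_le _ sS).
set w := excess S B G H m.
have w_ge0 : forall s', 0 <= w s' by exact: excess_ge0.
have w_B s' : s' \in B -> w s' = 0 by exact: excess_target.
have w_sub s' : s' \notin B -> w s' <= 1 + average (trans q) w s'.
  exact: excess_sub.
have w_super s' : s' \notin B -> average (trans q) w s' <= w s' + m * delta.
  exact: excess_super.
have m1 : 1 <= m * delta.
  by apply: (min_lower_bound p_ge0 p_sum1 SB GE HE smP m_ge0 S_le smS).
have Gt : (1 - delta) * m <= G t.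
  by apply: (return_lower_bound p_ge0 p_sum1 SB GE HE smP m_ge0).
have w_le s' : w s' <= crude_bound.
  exact: (subsolution_bound N_gt0 q_prob q_le alpha_lt1 alpha_ge0 B_neq0).
have kap_ge0 : 0 <= m * delta by rewrite mulr_ge0.
have wS s' : s' \in S -> w s' = G s' - m.
  by move=> s'S; rewrite /w /excess /return_prob (negbTE (SB _ s'S)) s'S mulr1.
have st : meso R L s = meso R L sm by move: smS; rewrite lev => /eqP.
have := harnack N_gt0 q_prob q_le alpha_lt1 L_part A2 rho_ge1 ratio B_level
  w_ge0 w_le w_B kap_ge0 w_sub w_super u alpha_ge0 st.
rewrite (wS _ sS) (wS _ smS) subrr add0r.
set d := #|disagree s sm|.
have dN : (d <= N)%N by rewrite -[X in (_ <= X)%N]card_ord max_card.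
have cost_le := coupling_cost_le N alpha rho_ge1 u%:R dN.
have fail_le := ler_wpM2l crude_bound_ge0 (meeting_failure_le N alpha u%:R dN).
set c := coupling_cost _ _ _ N _ in cost_le *; set c' := coupling_cost _ _ _ d _ in cost_le *.
move=> Gs.
have {Gs fail_le} : G s <= m * (1 + delta * (u%:R + c * u%:R + 1)).
  have h : c' * (u%:R * (m * delta)) <= c * (u%:R * (m * delta)).
    by rewrite ler_wpM2r// mulr_ge0.
  have h' : u%:R <= m * delta * u%:R by rewrite ler_peMl.
  lra.
set X := 1 + _ => Gs.
have X0 : 0 <= X.
  by rewrite !addr_ge0// mulr_ge0// !addr_ge0// mulr_ge0// coupling_cost_ge0.
apply: (@le_trans _ _ ((1 - delta) * (m * X))).
  by rewrite ler_wpM2l// subr_ge0.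
by rewrite mulrA mulrC ler_wpM2l.
Qed.

End MeanHit.

(** * The law of the hitting time *)

Section PathLaw.
Context (R : realType) (T : finType) (p : T -> T -> R) (s0 : T).
Context (d : measure_display) (Om : measurableType d) (P : probability Om R).
Context (X : nat -> Om -> T) (PX : markov_chain p s0 P X).
Implicit Types (Q : nat -> pred T) (D B : {set T}) (a b c : T).

Let X_meas a t : measurable (X t @^-1` [set a]).
Proof. by case: PX => XP _ _. Qed.

Lemma measurable_visit t (A : set T) : measurable (X t @^-1` A).
Proof.
rewrite (_ : _ @^-1` A = \bigcup_(a in A) (X t @^-1` [set a])).
  by apply: fin_bigcup_measurable.
by apply/seteqP; split=> [w Aw|w [a Aa] /= ->//]; exists (X t w).
Qed.

Lemma measurable_forall (F : nat -> set Om) :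
  (forall i, measurable (F i)) -> measurable [set w | forall i, F i w].
Proof.
move=> mF; rewrite (_ : [set _ | _] = \bigcap_i F i); first exact: bigcapT_measurable.
by apply/seteqP; split=> [w Fw i _|w Fw i]; [exact: Fw|exact: (Fw i)].
Qed.

Lemma probability_split t (E : set Om) : measurable E ->
  P E = (\sum_(a : T) P (E `&` X t @^-1` [set a]))%E.
Proof.
move=> mE; rewrite {1}(_ : E = \bigcup_(a in setT) (E `&` X t @^-1` [set a])).
  rewrite measure_fin_bigcup//.
  - have all_enum : [set` index_enum T] = setT.
      by apply/seteqP; split=> // a _ /=; rewrite mem_index_enum.
    by rewrite -all_enum -fsbig_seq// index_enum_uniq.
  - exact: finite_finset.
  - apply/classical_sets.trivIsetP => a b _ _ ab; rewrite -subset0 => w [[_ /= Xa] [_ /= Xb]].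
    by rewrite -Xa -Xb eqxx in ab.
  - by move=> a _; exact: measurableI.
by apply/seteqP; split=> [w Ew|w [a _ []]//]; exists (X t w).
Qed.

(** Interpolates between cylinders (j = 0), on which the Markov property is
    given, and events in which only the last positions are prescribed. *)
Definition path_event Q (s : nat -> T) (j n : nat) : set Om :=
  [set w | forall i, ((i < j)%N -> Q i (X i w)) /\ ((j <= i <= n)%N -> X i w = s i)].

Lemma measurable_path_event Q s j n : measurable (path_event Q s j n).
Proof.
apply: measurable_forall => i.
rewrite (_ : (fun w => _) = X i @^-1` [set a | ((i < j)%N -> Q i a) /\
  ((j <= i <= n)%N -> a = s i)]) //.
exact: measurable_visit.
Qed.

(** Induction on j: freeing the position at time j amounts to summing over its
    possible values the identity with that position prescribed. *)
Lemma path_event_markov Q s j t : (j <= t)%N ->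
  P (path_event Q s j t.+1) = (P (path_event Q s j t) * (p (s t) (s t.+1))%:E)%E.
Proof.
elim: j s => [|j IH] s jt.
  have cylE n : path_event Q s 0 n = cylinder X s n.
    by apply/seteqP; split=> w h i; [move=> i_n; apply: (h i).2|split=> // /h].
  by rewrite !cylE; case: PX.
pose s' a i := if i == j then a else s i.
have cut n a : (j <= n)%N -> path_event Q s j.+1 n `&` X j @^-1` [set a] =
    if Q j a then path_event Q (s' a) j n else set0.
  move=> jn; apply/seteqP; split=> w.
    move=> [h /= Xj]; have Qa : Q j a by rewrite -Xj; apply: (h j).1.
    rewrite Qa => i; split=> [ij|/andP[ji i_n]].
      by apply: (h i).1; rewrite ltnS ltnW.
    rewrite /s'; case: eqP => [->//|/eqP ij].
    by apply: (h i).2; rewrite i_n andbT ltn_neqAle eq_sym ij.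
  case: ifP => // Qa h; split; last first.
    by have := (h j).2; rewrite leqnn jn /s' eqxx; apply.
  move=> i; split=> [|/andP[ji i_n]].
    rewrite ltnS leq_eqVlt => /predU1P[->|ij]; last exact: (h i).1.
    by rewrite (h j).2 ?leqnn// /s' eqxx.
  rewrite (h i).2 ?i_n ?(ltnW ji)// /s'.
  by case: eqP => // ij; rewrite ij ltnn in ji.
rewrite (probability_split j (measurable_path_event _ _ _ t.+1)).
rewrite (probability_split j (measurable_path_event _ _ _ t)).
rewrite ge0_sume_distrl//; apply: eq_bigr => a _.
rewrite !cut; [|exact: ltnW|exact/ltnW/ltnW].
case: ifP => _; last by rewrite measure0 mul0e.
rewrite IH; last exact: ltnW.
by rewrite /s' !gtn_eqF// ltnW.
Qed.

Definition avoids D t : set Om :=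
  [set w | forall i, (0 < i <= t)%N -> X i w \notin D].

Lemma measurable_avoids D t : measurable (avoids D t).
Proof.
apply: measurable_forall => i.
rewrite (_ : (fun w => _) = X i @^-1` [set a | (0 < i <= t)%N -> a \notin D]) //.
exact: measurable_visit.
Qed.

Definition avoid_at D t a : R := fine (P (avoids D t `&` X t @^-1` [set a])).

Lemma avoid_atE D t a :
  P (avoids D t `&` X t @^-1` [set a]) = (avoid_at D t a)%:E.
Proof.
rewrite fineK// fin_num_measure//; apply: measurableI => //.
exact: measurable_avoids.
Qed.

Lemma avoid_step D t a b :
  P ((avoids D t `&` X t @^-1` [set a]) `&` X t.+1 @^-1` [set b]) =
  (avoid_at D t a * p a b)%:E.
Proof.
pose Q i c := (0 < i)%N ==> (c \notin D).
pose s i := if i == t then a else b.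
have [aD|aD] := boolP ((0 < t)%N && (a \in D)).
  have avoid0 : avoids D t `&` X t @^-1` [set a] = set0.
    apply/seteqP; split=> // w [h /= Xt]; move/andP: aD => [t0].
    by rewrite -Xt => XD; have := h t; rewrite t0 leqnn XD => /(_ isT).
  by rewrite /avoid_at avoid0 set0I measure0 mul0r.
have Qa : (0 < t)%N -> a \notin D by move=> t0; rewrite t0 in aD.
have E1 : path_event Q s t t = avoids D t `&` X t @^-1` [set a].
  apply/seteqP; split=> w.
    move=> h; have Xt : X t w = a by have := (h t).2; rewrite leqnn /s eqxx; apply.
    split=> // i /andP[i0]; rewrite leq_eqVlt => /predU1P[it|it].
      by rewrite it Xt Qa// -it.
    by have := (h i).1 it; rewrite /Q i0.
  move=> [h /= Xt] i; split=> [it|]; first by rewrite /Q; apply/implyP => i0; apply: (h i); rewrite i0 ltnW.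
  by rewrite -eqn_leq => /eqP <-; rewrite /s eqxx.
have E2 : path_event Q s t t.+1 =
    (avoids D t `&` X t @^-1` [set a]) `&` X t.+1 @^-1` [set b].
  rewrite -E1; apply/seteqP; split=> w.
    move=> h; split=> [i|].
      split=> [|/andP[ti it]]; first exact: (h i).1.
      by apply: (h i).2; rewrite ti ltnW.
    by have := (h t.+1).2; rewrite leqnn leqnSn /s gtn_eqF//; apply.
  move=> [h /= Xt] i; split=> [|/andP[ti]]; first exact: (h i).1.
  rewrite leq_eqVlt => /predU1P[->|it]; first by rewrite Xt /s gtn_eqF.
  by apply: (h i).2; rewrite ti.
by rewrite -E2 path_event_markov// E1 avoid_atE /s eqxx gtn_eqF// EFinM.
Qed.

Lemma avoid_at0 D a : avoid_at D 0 a = (a == s0)%:R.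
Proof.
have [_ P0 _] := PX.
have avoids0 : avoids D 0 = setT.
  by apply/seteqP; split=> // w _ i /andP[i0]; rewrite leqNgt i0.
rewrite /avoid_at avoids0 setTI; have [->|as0] := eqVneq a s0; first by rewrite P0.
suff -> : P (X 0%N @^-1` [set a]) = 0%E by [].
apply/eqP; rewrite eq_le measure_ge0 andbT.
have <- : P (~` (X 0%N @^-1` [set s0])) = 0%E.
  by rewrite probability_setC// [X in (_ - X)%E]P0 subee.
apply: le_measure; rewrite ?inE//; first exact: measurableC.
by move=> w /= Xa Xs; rewrite -Xa Xs eqxx in as0.
Qed.

Lemma avoid_atS D t b :
  avoid_at D t.+1 b = \sum_a avoid_at D t a * killed p D a b.
Proof.
apply: EFin_inj; rewrite -avoid_atE.
have [bD|bD] := boolP (b \in D).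
  rewrite big1 => [|a _]; last by rewrite /killed bD mulr0.
  rewrite (_ : _ `&` _ = set0) ?measure0//.
  apply/seteqP; split=> // w [h /= Xt].
  by have := h t.+1; rewrite leqnn Xt bD => /(_ isT).
have -> : avoids D t.+1 `&` X t.+1 @^-1` [set b] =
    avoids D t `&` X t.+1 @^-1` [set b].
  apply/seteqP; split=> w [h /= Xt]; split=> // i /andP[i0 it].
    by apply: h; rewrite i0 ltnW.
  move: it; rewrite leq_eqVlt => /predU1P[->|it]; first by rewrite Xt.
  by apply: h; rewrite i0.
rewrite (probability_split t); last first.
  by apply: measurableI => //; exact: measurable_avoids.
rewrite -sumEFin; apply: eq_bigr => a _.
by rewrite setIAC avoid_step /killed (negbTE bD).
Qed.

(** The left-hand side evolves by the transposed killed kernel, from the mass at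
    s0; the right-hand side is the dual expression. *)
Lemma avoid_atP D t (f : T -> R) :
  \sum_a avoid_at D t a * f a = iter t (average (killed p D)) f s0.
Proof.
elim: t f => [|t IH] f.
  rewrite (bigD1 s0)//= avoid_at0 eqxx mul1r big1 ?addr0// => a as0.
  by rewrite avoid_at0 (negbTE as0) mul0r.
rewrite iterSr -IH.
under eq_bigr do rewrite avoid_atS mulr_suml.
rewrite exchange_big; apply: eq_bigr => a _.
by rewrite mulr_sumr; apply: eq_bigr => b _; rewrite mulrA.
Qed.

Lemma probability_avoids D t :
  P (avoids D t) = (iter t (average (killed p D)) (fun=> 1%R) s0)%:E.
Proof.
rewrite (probability_split t (measurable_avoids _ _)) -avoid_atP -sumEFin.
by apply: eq_bigr => a _; rewrite avoid_atE mulr1.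
Qed.

Definition enters D B t : set Om := avoids D t `&` [set w | X t.+1 w \in B].

Lemma measurable_enters D B t : measurable (enters D B t).
Proof.
apply: measurableI; first exact: measurable_avoids.
exact: (measurable_visit t.+1 [set a | a \in B]).
Qed.

Lemma probability_enters D B t : P (enters D B t) =
  (iter t (average (killed p D)) (fun s => \sum_(b in B) p s b) s0)%:E.
Proof.
rewrite (probability_split t (measurable_enters _ _ _)) -avoid_atP -sumEFin.
apply: eq_bigr => a _.
have mE : measurable (enters D B t `&` X t @^-1` [set a]).
  by apply: measurableI => //; exact: measurable_enters.
rewrite (probability_split t.+1 mE) mulr_sumr [in RHS]big_mkcond -sumEFin /=.
apply: eq_bigr => b _; case: ifPn => bB.
  rewrite -avoid_step; congr (P _); apply/seteqP; split=> w.
    by move=> [[[h1 h2] h3] h4].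
  by move=> [[h1 h2] /= h3]; split=> //; split=> //; split=> //=; rewrite h3.
rewrite (_ : _ `&` _ = set0) ?measure0//; apply/seteqP; split=> // w.
by move=> [[[_ /= XB] _] /= Xb]; rewrite Xb (negbTE bB) in XB.
Qed.

End PathLaw.

Section HitLaw.
Context (R : realType) (T : finType) (p : T -> T -> R) (s0 : T).
Context (d : measure_display) (Om : measurableType d) (P : probability Om R).
Context (X : nat -> Om -> T) (PX : markov_chain p s0 P X).
Implicit Types (D S B : {set T}) (w : Om).

Lemma hit_ge D t w : avoids X D t w -> (t.+1%:R%:E <= hit R X D w)%E.
Proof.
move=> h; apply: le_ereal_inf_tmp => _ [i [i0 Xi] <-].
rewrite lee_fin ler_nat ltnNge; apply/negP => it.
by have := h i; rewrite i0 it Xi => /(_ isT).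
Qed.

Lemma hit_le D t w : (0 < t)%N -> X t w \in D -> (hit R X D w <= t%:R%:E)%E.
Proof. by move=> t0 Xt; apply: ereal_inf_lbound; exists t. Qed.

Lemma hit_cases D w :
  (exists t, avoids X D t w /\ X t.+1 w \in D) \/ (forall t, avoids X D t w).
Proof.
have [h|h] := pselect (exists t, X t.+1 w \in D); last first.
  right=> t [//|i] _; apply/negP => Xi; apply: h; by exists i.
left; case: (ex_minnP h) => t Xt tmin; exists t; split=> // -[//|i] /= it.
by apply: contraL it => /tmin ti; rewrite -leqNgt.
Qed.

(** Both sides are the number of times t such that the target is avoided up to
    time t, possibly infinite. *)
Lemma hit_series D w :
  hit R X D w = (\sum_(0 <= t <oo) (\1_(avoids X D t) w)%:E)%E.
Proof.
have avoids_le t t' : (t' <= t)%N -> avoids X D t w -> avoids X D t' w.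
  by move=> tt' h i /andP[i0 it]; apply: h; rewrite i0 (leq_trans it).
have [[n [avn Xn]]|never] := hit_cases D w.
  have -> : hit R X D w = n.+1%:R%:E.
    by apply/eqP; rewrite eq_le hit_ge// hit_le.
  apply/esym/cvg_lim => //; apply: cvg_near_cst; exists n.+1 => // m /= nm.
  rewrite (big_cat_nat (leq0n n.+1) nm)/= sumEFin sumEFin -EFinD; congr (_%:E).
  rewrite (eq_big_nat _ _ (F2 := fun=> 1)); last first.
    by move=> t /andP[_ tn]; rewrite indicE mem_set//; exact: avoids_le avn.
  rewrite [X in _ + X]big_nat_cond [X in _ + X]big1 ?addr0; last first.
    move=> t /andP[/andP[nt _] _]; rewrite indicE memNset// => h.
    by have := h n.+1; rewrite nt Xn => /(_ isT).
  by rewrite sumr_const_nat subn0.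
have -> : hit R X D w = +oo%E.
  apply/eqyP => r r0; apply: (@le_trans _ _ (Num.truncn r).+1%:R%:E).
    by rewrite lee_fin ltW// truncnS_gt.
  exact: hit_ge.
apply/esym/cvg_lim => //.
rewrite (_ : (fun n => _) = (fun n => (n%:R : R)%:E)); first by apply/cvgenyP.
apply/funext => n; rewrite sumEFin; congr (_%:E).
rewrite (eq_bigr (fun=> 1)) ?sumr_const_nat ?subn0// => t _.
by rewrite indicE mem_set.
Qed.

Context (p_ge0 : forall s s', 0 <= p s s').

Let killed_p_ge0 D s s' : 0 <= killed p D s s'.
Proof. by rewrite /killed; case: ifP. Qed.

Lemma integral_hit B M : (forall n s, green (killed p B) (fun=> 1) n s <= M) ->
  (\int[P]_w hit R X B w)%E = (green_lim (killed p B) (fun=> 1) s0)%:E.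
Proof.
move=> gM; have mav t := measurable_avoids PX B t.
under eq_integral do rewrite hit_series.
rewrite integral_nneseries//; last first.
  by move=> t; apply/measurable_EFinP; exact: measurable_indic.
have -> : (\sum_(0 <= t <oo) \int[P]_w (\1_(avoids X B t) w)%:E)%E =
    (\sum_(0 <= t <oo) (iter t (average (killed p B)) (fun=> 1%R) s0)%:E)%E.
  apply: eq_eseriesr => t _.
  by rewrite integral_indic// setIT; exact: (probability_avoids PX B t).
apply: cvg_lim => //.
rewrite (_ : (fun n => _) = EFin \o (fun n => green (killed p B) (fun=> 1) n s0)).
  apply: cvg_EFin; first exact: nearW.
  by apply: (green_cvg (M := M)) => //; exact: killed_p_ge0.
by apply/funext => n; rewrite /= sumEFin green_sum.
Qed.

(** A description by countably many coordinate events; it shows in particular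
    that the event in hypothesis (R) is measurable. *)
Lemma hit_lt_enters S B : (forall s, s \in S -> s \notin B) ->
  [set w | (hit R X B w < hit R X S w)%E] =
  \bigcup_t enters X (S :|: B) B t.
Proof.
move=> SB; apply/seteqP; split=> w.
  move=> /= BS; have [[t [avt Xt]]|never] := hit_cases B w; last first.
    move: BS; rewrite ltNge => /negP[]; have [[t [avt Xt]]|neverS] := hit_cases S w.
      by apply: (le_trans (hit_le _ Xt)) => //; exact: hit_ge.
    by rewrite !hit_series; apply: lee_nneseries => // t _; rewrite !indicE !mem_set.
  exists t => //; split=> // i /andP[i0 it].
  rewrite finset.in_setU negb_or (avt i) ?i0// andbT; apply/negP => Xi.
  move: BS; rewrite ltNge => /negP[]; apply: (le_trans (hit_le i0 Xi)).
  apply: le_trans (hit_ge avt); rewrite lee_fin ler_nat; exact: leqW.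
move=> [t _ [h /= Xt]] /=.
apply: (@le_lt_trans _ _ t.+1%:R%:E); first exact: hit_le.
apply: (@lt_le_trans _ _ t.+2%:R%:E); first by rewrite lte_fin ltr_nat.
apply: hit_ge => i /andP[i0]; rewrite leq_eqVlt => /predU1P[->|it].
  by have [XS|//] := boolP (X t.+1 w \in S); have := SB _ XS; rewrite Xt.
by have := h i; rewrite i0 -ltnS it finset.in_setU negb_or => /(_ isT)/andP[].
Qed.

Lemma green_escape_le S B (x : R) n : (forall s, s \in S -> s \notin B) ->
  (P [set w | hit R X B w < hit R X S w] <= x%:E)%E ->
  green (killed p (S :|: B)) (fun s => \sum_(b in B) p s b) n s0 <= x.
Proof.
move=> SB; rewrite (hit_lt_enters SB) => Px; rewrite -lee_fin.
apply: le_trans Px; rewrite measure_semi_bigcup; last 3 first.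
- by move=> t; exact: (measurable_enters PX).
- apply/classical_sets.trivIsetP => t t' _ _.
  wlog tt' : t t' / (t < t')%N => [th|_].
    move=> tt'; move: (tt'); rewrite neq_ltn => /orP[] lt_tt'.
      exact: th.
    by rewrite setIC; apply: th => //; rewrite eq_sym.
  rewrite -subset0 => w [[_ /= Xt] [h _]].
  by have := h t.+1; rewrite tt' finset.in_setU Xt orbT => /(_ isT).
- by apply: bigcup_measurable => t _; exact: (measurable_enters PX).
rewrite green_sum -sumEFin.
under eq_bigr do rewrite -(probability_enters PX).
exact: nneseries_lim_ge.
Qed.

End HitLaw.

(** * Choice of the constants *)

Section Asymptotics.
Context (R : realType).
Implicit Types (N K : nat) (alpha rho C a : R).

(** N <= e^N and N^N / N! <= e^N, both read off the exponential series. *)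
Lemma crude_bound_le N alpha : (0 < N)%N -> alpha < 1 ->
  crude_bound N alpha <= (expR 1 ^+ 2 / (1 - alpha)) ^+ N.
Proof.
move=> N0 al1; have N0' : 0 < N%:R :> R by rewrite ltr0n.
have al : 0 < 1 - alpha by rewrite subr_gt0.
have f0 : 0 < N`!%:R :> R by rewrite ltr0n fact_gt0.
have factN : N%:R ^+ N <= N`!%:R * expR 1 ^+ N :> R.
  rewrite -expRM_natl mulr1 mulrC -ler_pdivrMr//.
  have := @expR_ge1Dxn R N%:R N.-1 (ler0n _ _); rewrite prednK//.
  by apply: le_trans; rewrite lerDr.
have N_le : N%:R <= expR 1 ^+ N :> R.
  by rewrite -expRM_natl mulr1 (le_trans _ (expR_ge1Dx _))// lerDr.
rewrite /crude_bound /reach_prob ler_pdivrMr; last first.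
  by rewrite mulr_gt0// exprn_gt0// divr_gt0.
have -> : (expR 1 ^+ 2 / (1 - alpha)) ^+ N *
    (N`!%:R * ((1 - alpha) / N%:R) ^+ N) =
    expR 1 ^+ N * ((N`!%:R * expR 1 ^+ N) / N%:R ^+ N) :> R.
  rewrite !expr_div_n exprAC expr2; field.
  by rewrite !expf_neq0// gt_eqF.
rewrite -[leLHS]mulr1; apply: ler_pM => //.
by rewrite ler_pdivlMr ?mul1r// exprn_gt0.
Qed.

(** Failing to meet within the budget K N^2 has probability at most
    (2 e^(-(1 - alpha) K / 2))^N, and K is taken so large that this beats the a
    priori bound on mean hitting times. *)
Lemma meeting_failure_small alpha : alpha < 1 ->
  exists K, forall N, (0 < N)%N ->
    crude_bound N alpha * meeting_failure N alpha N (K * N ^ 2)%:R <= 1.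
Proof.
move=> al1; have al : 0 < 1 - alpha by rewrite subr_gt0.
set W1 := expR 1 ^+ 2 / (1 - alpha).
have W0 : 0 <= W1 by rewrite divr_ge0 ?exprn_ge0 ?expR_ge0// ltW.
exists (Num.truncn (2 * W1 * 2 / (1 - alpha))).+1 => N N0.
set K := _.+1; have N0' : 0 < N%:R :> R by rewrite ltr0n.
have KW : 2 * W1 <= expR ((1 - alpha) / 2 * K%:R).
  apply: (le_trans _ (expR_ge1Dx _)); apply: ler_wpDl => //.
  have : 2 * W1 * 2 / (1 - alpha) <= K%:R by rewrite ltW// truncnS_gt.
  by clearbody K W1; rewrite ler_pdivrMr//; lra.
clearbody K; have -> : meeting_failure N alpha N (K * N ^ 2)%:R =
    (2 / expR ((1 - alpha) / 2 * K%:R)) ^+ N.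
  rewrite /meeting_failure expr_div_n -expRM_natl -expRN; congr (_ * expR _).
  by rewrite natrM natrX; field; rewrite gt_eqF.
apply: le_trans (ler_wpM2r _ (crude_bound_le N0 al1)) _.
  by rewrite exprn_ge0// divr_ge0// expR_ge0.
rewrite -exprMn exprn_ile1//; first by rewrite mulr_ge0// divr_ge0// expR_ge0.
by rewrite mulrA ler_pdivrMr ?expR_gt0// mul1r mulrC.
Qed.

(** For fixed K the loss per site vanishes as rho tends to 1. *)
Lemma coupling_cost_small N K alpha rho C : (0 < N)%N -> alpha < 1 -> 1 <= rho ->
  (rho - 1) * (1 + K%:R / (1 - alpha)) <= C / 4 ->
  coupling_cost N alpha rho N (K * N ^ 2)%:R <= expR (C * N%:R / 4).
Proof.
move=> N0 al1 rho1 small; have N0' : 0 < N%:R :> R by rewrite ltr0n.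
have rho_le : rho ^+ N <= expR ((rho - 1) * N%:R).
  rewrite expRM_natr lerXn2r ?nnegrE ?expR_ge0// ?(le_trans _ rho1)//.
  by rewrite (le_trans _ (expR_ge1Dx _))// addrC subrK.
apply: (le_trans (ler_wpM2r (expR_ge0 _) rho_le)).
rewrite -expRD ler_expR.
have -> : (rho - 1) * N%:R + (rho - 1) / (1 - alpha) * ((K * N ^ 2)%:R / N%:R) =
    ((rho - 1) * (1 + K%:R / (1 - alpha))) * N%:R.
  by rewrite natrM natrX; field; rewrite !gt_eqF// subr_gt0.
by rewrite [leRHS]mulrAC ler_wpM2r.
Qed.

(** The left-hand side is at most e^(-3 C N / 4) times a polynomial in N; the
    cubic term of the exponential series dominates the polynomial. *)
Lemma defect_small K C a : 0 < C -> 0 <= a ->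
  exists2 N0, (0 < N0)%N & forall N, (N0 <= N)%N -> forall c,
    c <= expR (C * N%:R / 4) ->
    a * expR (- (C * N%:R)) * ((K * N ^ 2)%:R + c * (K * N ^ 2)%:R + 1)
      + 2 * (a * expR (- (C * N%:R))) <= expR (- (C * N%:R / 2)).
Proof.
move=> C0 a0; set b := a * (2 * K%:R + 3) * 384 / C ^+ 3.
exists (Num.truncn b).+1 => // N bN c c_le.
set delta := a * _; set u := (K * N ^ 2)%:R.
have N1 : (0 < N)%N by exact: leq_trans bN.
have N0 : 0 < N%:R :> R by rewrite ltr0n.
have N1' : 1 <= N%:R :> R by rewrite ler1n.
have {}bN : b <= N%:R by rewrite (le_trans (ltW (truncnS_gt _)))// ler_nat.
set x := C * N%:R / 4; rewrite -/x in c_le.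
have x0 : 0 <= x by rewrite !mulr_ge0// ltW.
have e1 : 1 <= expR x by rewrite -[leLHS]expR0 ler_expR.
have poly : a * (2 * u + 3) <= expR x.
  apply: le_trans (_ : x ^+ 3 / 6 <= _); last first.
    have := @expR_ge1Dxn R x 2 x0; rewrite (_ : 3`! = 6%N)//.
    by apply: le_trans; rewrite lerDr.
  have u_le : a * (2 * u + 3) <= a * (2 * K%:R + 3) * N%:R ^+ 2.
    rewrite -mulrA ler_wpM2l// /u natrM natrX.
    have : 1 <= N%:R ^+ 2 :> R by rewrite exprn_ege1.
    by lra.
  apply: (le_trans u_le).
  have C3 : 0 < C ^+ 3 by rewrite exprn_gt0.
  move: bN; rewrite /b ler_pdivrMr// => bN.
  have -> : x ^+ 3 / 6 = (N%:R * C ^+ 3) * N%:R ^+ 2 / 384 by rewrite /x; field.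
  rewrite ler_pdivlMr// mulrAC ler_wpM2r//.
have u0 : 0 <= u by rewrite ler0n.
have d0 : 0 <= delta by rewrite mulr_ge0 ?expR_ge0.
apply: (@le_trans _ _ (delta * (expR x * (2 * u + 3)))).
  have -> : delta * (u + c * u + 1) + 2 * delta = delta * (u + c * u + 3) by ring.
  rewrite ler_wpM2l//.
  have := ler_wpM2r u0 c_le; have := ler_wpM2r u0 e1; lra.
have -> : delta * (expR x * (2 * u + 3)) =
    (a * (2 * u + 3)) * (expR x * expR (- (4 * x))).
  by rewrite /delta (_ : C * N%:R = 4 * x); [ring|rewrite /x; field].
apply: (le_trans (ler_wpM2r _ poly)); first by rewrite mulr_ge0 ?expR_ge0.
by rewrite -!expRD ler_expR (_ : C * N%:R / 2 = 2 * x); [lra|rewrite /x; field].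
Qed.

End Asymptotics.

Lemma refines_meso_le (R : realType) (N : nat) (k : nat -> nat)
    (L : forall n, 'I_(k n) -> {set 'I_N}) (n0 n : nat) (s t : config N) :
  (0 < N)%N -> (forall m, is_partition (L m)) ->
  (forall m, refines (L m.+1) (L m)) -> (n0 <= n)%N ->
  meso R (L n) s = meso R (L n) t -> meso R (L n0) s = meso R (L n0) t.
Proof.
move=> N0 part ref; elim: n => [|n IH]; first by rewrite leqn0 => /eqP ->.
rewrite leq_eqVlt => /predU1P[->//|]; rewrite ltnS => n0n st.
by apply: IH => //; exact: (refines_meso N0 (part n) (part n.+1) (ref n) st).
Qed.

Lemma ratio_close (R : realType) (x y e : R) : 0 < x -> 0 < y -> 0 <= e ->
  x <= (1 + e) * y -> y <= (1 + e) * x -> (`|x%:E / y%:E - 1| <= e%:E)%E.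
Proof.
move=> x0 y0 e0 xy yx.
rewrite inver gt_eqF// -EFinM -EFinB abse_EFin lee_fin ler_norml.
apply/andP; split; last by rewrite lerBlDl ler_pdivrMr.
rewrite lerBrDl ler_pdivlMr//; nra.
Qed.

Theorem theorem1p1 (R : realType)
    (q : forall N : nat, 'I_N -> bool -> config N -> R)
    (mu : forall N : nat, config N -> R)
    (alpha : R)
    (d : measure_display) (Om : nat -> measurableType d)
    (P : forall N : nat, config N -> probability (Om N) R)
    (X : forall N : nat, nat -> Om N -> config N)
    (k : nat -> nat -> nat)
    (L : forall N n : nat, 'I_(k N n) -> {set 'I_N})
    (eps : nat -> R)
    (n0 : nat)
    (bA bB : forall N : nat, set 'rV[R]_(k N n0))
    (C : R) (a : nat -> R) :
  1 / 2 <= alpha < 1 ->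
  (forall N, (0 < N)%N -> update_probabilities (q N)) ->
  (forall N, (0 < N)%N -> forall x b s, q N x b s <= alpha) ->
  (forall N, (0 < N)%N -> prob_mass (mu N)) ->
  (forall N, (0 < N)%N -> reversible (trans (q N)) (mu N)) ->
  (forall N, (0 < N)%N -> forall s : config N,
     markov_chain (trans (q N)) s (P N s) (X N)) ->
  (forall N n, (0 < N)%N -> is_partition (L N n)) ->
  (forall N n, (0 < N)%N -> refines (L N n.+1) (L N n)) ->
  (forall n m, (n <= m)%N -> eps m <= eps n) ->
  eps @ \oo --> (0 : R) ->
  (forall n N, (0 < N)%N ->
     assumption_A1 (L N n) (mu N) (trans (q N)) (eps n)) ->
  (forall n N, (0 < N)%N -> assumption_A2 (L N n) (q N)) ->
  (forall N, (0 < N)%N ->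
     bA N `<=` Gamma (L N n0) /\ bB N `<=` Gamma (L N n0)) ->
  (forall N, (0 < N)%N ->
     meso_set (L N n0) (bA N) :&: meso_set (L N n0) (bB N) = finset.set0) ->
  0 < C ->
  (forall n N, (n0 <= n)%N -> (0 < N)%N -> forall s t : config N,
     s \in meso_set (L N n0) (bA N) -> t \in meso_set (L N n0) (bA N) ->
     (P N s [set w | hit R (X N) (meso_set (L N n0) (bB N)) w
                     < hit R (X N) (level (L N n) (meso R (L N n) t)) w]
      <= (a n * expR (- (C * N%:R)))%:E)%E) ->
  exists N0 : nat, forall N, (N0 <= N)%N -> bB N !=set0 ->
    forall s t : config N,
    s \in meso_set (L N n0) (bA N) -> t \in meso_set (L N n0) (bA N) ->
    (`| (\int[P N s]_w hit R (X N) (meso_set (L N n0) (bB N)) w)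
          / (\int[P N t]_w hit R (X N) (meso_set (L N n0) (bB N)) w) - 1 |
     <= (expR (- (C * N%:R / 2)))%:E)%E.
Proof.
move=> /andP[alpha_ge alpha_lt1] q_prob q_le mu_prob mu_rev chain part ref.
move=> _ eps0 A1 A2 bAB AB C_gt0 rec.
have alpha_ge0 : 0 <= alpha by lra.
have al : 0 < 1 - alpha by rewrite subr_gt0.
have [K failure_small] := meeting_failure_small alpha_lt1.
(* eps n <= e makes the coupling cost at most e^(C N / 4); the budget constant
   K depends on alpha only and is fixed before the level n. *)
set cK := 1 + K%:R / (1 - alpha).
have cK_ge1 : 1 <= cK by rewrite lerDl divr_ge0// ltW.
have cK_gt0 : 0 < cK by exact: lt_le_trans cK_ge1.
pose e := Num.min (1 / 2) (C / (16 * cK)).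
have e_gt0 : 0 < e by rewrite lt_min divr_gt0//= divr_gt0// mulr_gt0.
have e_le : e <= 1 / 2 by rewrite ge_min lexx.
have e_small : 16 * e * cK <= C.
  have : e <= C / (16 * cK) by rewrite ge_min lexx orbT.
  by rewrite ler_pdivlMr ?mulr_gt0//; lra.
have [n n0n eps_n] : exists2 n, (n0 <= n)%N & eps n <= e.
  have [m _ hm] : \forall n \near \oo, `|0 - eps n| < e.
    by move/cvgrPdist_lt : eps0; apply.
  exists (maxn n0 m); first exact: leq_maxl.
  have := hm (maxn n0 m) (leq_maxr _ _); rewrite /= sub0r normrN.
  by move/ltW; apply: le_trans; exact: ler_norm.
pose rho : R := 1 + 4 * e.
have rho_ge1 : 1 <= rho by rewrite lerDl mulr_ge0// ltW.
have [N0 N0_gt0 defect] := @defect_small R K C `|a n| C_gt0 (normr_ge0 _).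
exists N0 => N N0N [v Bv].
have N_gt0 : (0 < N)%N by exact: leq_trans N0N.
set B := meso_set (L N n0) (bB N); set A := meso_set (L N n0) (bA N).
set delta := `|a n| * expR (- (C * N%:R)).
set G := mean_hit (q N) B.
have same_n0 (s t : config N) : meso R (L N n) s = meso R (L N n) t ->
    meso R (L N n0) s = meso R (L N n0) t.
  exact: (refines_meso_le N_gt0 (fun m => part N m N_gt0)
            (fun m => ref N m N_gt0) n0n).
have B_level (s t : config N) : meso R (L N n) s = meso R (L N n) t ->
    (s \in B) = (t \in B).
  by move=> /same_n0 st; rewrite !finset.inE st.
have A_level (s t : config N) : meso R (L N n) s = meso R (L N n) t ->
    (s \in A) = (t \in A).
  by move=> /same_n0 st; rewrite !finset.inE st.
have A_notin_B s : s \in A -> s \notin B.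
  move=> sA; apply/negP => sB; have := finset.in_set0 s.
  by rewrite -(AB N N_gt0) finset.in_setI sA sB.
have B_neq0 : B != finset.set0.
  have [s _ sv] := (bAB N N_gt0).2 v Bv.
  by apply/set0Pn; exists s; rewrite finset.inE sv; apply/mem_set.
have A1e : assumption_A1 (L N n) (mu N) (trans (q N)) e.
  move=> v1 v2 g1 g2 r s s' sv s'v p_gt0.
  exact: le_trans (A1 n N N_gt0 v1 v2 g1 g2 r s s' sv s'v p_gt0) eps_n.
have ratio := fun s t x y => @rate_ratio R N (q N) alpha (mu N) N_gt0
  (q_prob N N_gt0) (q_le N N_gt0) alpha_lt1 (mu_prob N N_gt0)
  (mu_rev N N_gt0) _ (L N n) (part N n N_gt0) e s t x y A1e (ltW e_gt0) e_le.
have p_ge0 := trans_ge0 (q_prob N N_gt0).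
have greenB_le := mean_hit_green_le N_gt0 (q_prob N N_gt0) (q_le N N_gt0)
  alpha_lt1 alpha_ge0 B_neq0.
have intE s : (\int[P N s]_w hit R (X N) B w)%E = (G s)%:E.
  exact: (integral_hit (chain N N_gt0 s) p_ge0 greenB_le).
have escape_le s t : s \in A -> t \in A ->
    escape_prob (q N) (level (L N n) (meso R (L N n) t)) B s <= delta.
  move=> sA tA; set S := level _ _.
  have SB s' : s' \in S -> s' \notin B.
    by rewrite finset.inE => /eqP s't; apply: A_notin_B; rewrite (A_level _ t).
  apply: green_lim_le => [s1 s2|s1|k' s1|k'].
  - exact: killed_ge0 (q_prob N N_gt0) _ _ _.
  - by rewrite sumr_ge0.
  - exact: escape_green_le1 N_gt0 (q_prob N N_gt0) _ _ _ _.
  - apply: (green_escape_le (chain N N_gt0 s) k' SB).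
    apply: (le_trans (rec n N n0n N_gt0 s t sA tA)).
    by rewrite lee_fin ler_wpM2r ?expR_ge0// ler_norm.
have cost_le : coupling_cost N alpha rho N (K * N ^ 2)%:R <= expR (C * N%:R / 4).
  apply: coupling_cost_small => //; rewrite -/cK /rho; lra.
have := defect N N0N _ cost_le; rewrite -/delta.
set X' := delta * _; set err := expR _ => X'_le.
have delta_ge0 : 0 <= delta by rewrite mulr_ge0 ?expR_ge0.
have err_le1 : err <= 1.
  by rewrite expR_le1 oppr_le0 divr_ge0// mulr_ge0// ltW.
have err_ge0 : 0 <= err by exact: expR_ge0.
have X'_ge0 : 0 <= X'.
  by rewrite mulr_ge0// !addr_ge0// mulr_ge0// coupling_cost_ge0.
have G_ge1 s : 1 <= G s.
  exact: (mean_hit_ge1 N_gt0 (q_prob N N_gt0) (q_le N N_gt0) alpha_lt1 alpha_ge0).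
have G_ratio s t : s \in A -> t \in A -> G s <= (1 + err) * G t.
  move=> sA tA.
  have S_le s' : s' \in level (L N n) (meso R (L N n) s) ->
      escape_prob (q N) (level (L N n) (meso R (L N n) s)) B s' <= delta.
    by rewrite finset.inE => /eqP s's; apply: escape_le; rewrite ?(A_level _ s).
  have delta_lt1 : delta < 1 by lra.
  have := mean_hit_ratio N_gt0 (q_prob N N_gt0) (q_le N N_gt0) alpha_lt1
    alpha_ge0 (part N n N_gt0) (A2 n N N_gt0) rho_ge1 ratio B_neq0 B_level
    (A_notin_B _ sA) (A_notin_B _ tA) (ltW delta_lt1) S_le
    (escape_le _ _ tA sA) (failure_small N N_gt0).
  rewrite -/X' -/G => Gst; have delta1 : 0 < 1 - delta by rewrite subr_gt0.
  rewrite -(ler_pM2l delta1); apply: (le_trans Gst); rewrite mulrA ler_wpM2r//.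
    exact: le_trans (G_ge1 t).
  have := ler_wpM2l delta_ge0 err_le1; lra.
move=> s t sA tA; rewrite !intE; apply: ratio_close => //.
- exact: lt_le_trans (G_ge1 s).
- exact: lt_le_trans (G_ge1 t).
- exact: G_ratio.
- exact: G_ratio.
Qed.
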